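(* Let $V$ be a vector space over a field $\mathbb{F}$ with a linearly ordered basis $\mathbb{B}$ and $p\in\mathbb{F}$ nonzero. Let $E,F\subseteq\mathbb{B}$ be finite and write the action of the braiding $\hat\tau$ of $\Lambda_p(V)$ as $$\hat\tau f_{E,F}=(-1)^{|E||F|}\sum_{k\ge0}\ \sum_{G,H}s_{E,G;F,H}\,f_{F',E'},\qquad E'=(E\setminus G)\cup H,\quad F'=(F\setminus H)\cup G,$$ where the inner sum runs over all $k$-element subsets $G\subseteq E\setminus F$ and $H\subseteq F\setminus E$. Then, for every $k\ge0$ and all $k$-element subsets $G\subseteq E\setminus F$, $H\subseteq F\setminus E$, $$s_{E,G;F,H}=\beta_{E,G;F,H}:=(-1)^{\theta_{F,E}+\theta_{F',E'}}\,p^{\theta_{G\sqcup C,E}+\theta_{\dot F,E'}}\,\alpha_{G,H},$$ where $C=E\cap F$, $\dot F=(F\setminus E)\setminus H$ and $\alpha_{G,H}=\prod_{g\in G}\big(p^{\theta_{\{g\},H}-\theta_{\{g\},G}}-1\big)$. Moreover, for generic $p$ (not a root of unity), this coefficient does not vanish if and only if $$\theta_{\{g\},H}>\theta_{\{g\},G}\quad\text{for all } g\in G.$$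
   Context: For $a,b\in\mathbb{B}$: $\theta_{a,b}=1$ if $a>b$ and $0$ otherwise; for finite subsets $\theta_{A,B}=\sum_{a\in A,b\in B}\theta_{a,b}$. Braided Hopf algebra $\Lambda_p(V)$: let $\tau$ on $V\otimes V$ be given by $\tau(a\otimes a)=-a\otimes a$; $\tau(a\otimes b)=-(1-p)a\otimes b-b\otimes a$ if $a>b$; $\tau(a\otimes b)=-p\,b\otimes a$ if $a<b$ ($a,b\in\mathbb{B}$). As an algebra $\Lambda_p(V)$ is the exterior algebra $\bigwedge V$, with product $\nabla$ and unit $1$. Its braiding $\hat\tau$ is the unique linear map on $\Lambda_p(V)^{\otimes2}$ with $\hat\tau|_{V\otimes V}=\tau$, $\hat\tau(1\otimes x)=x\otimes1$, $\hat\tau(x\otimes1)=1\otimes x$, $\hat\tau(\nabla\otimes\nabla)=(\nabla\otimes\nabla)(\mathrm{id}\otimes\hat\tau\otimes\mathrm{id})(\hat\tau\otimes\hat\tau)(\mathrm{id}\otimes\hat\tau\otimes\mathrm{id})$. For a finite $E=\{e_1<\dots<e_n\}\subseteq\mathbb{B}$, $f_E=e_1\cdots e_n$ ($f_\emptyset=1$); these form a basis of $\Lambda_p(V)$; $f_{E,F}=f_E\otimes f_F$. For fixed $E,F$, distinct pairs $(G,H)$ give distinct basis vectors $f_{F',E'}$, so the coefficients $s_{E,G;F,H}$ are well defined. *)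

(* Defs.v *)
From HB Require Import structures.
From mathcomp Require Import all_boot all_order all_algebra.
From mathcomp Require Import finmap boolp monalg.

Set Implicit Arguments.
Unset Strict Implicit.
Unset Printing Implicit Defensive.

Import Order.TTheory GRing.Theory.

Local Open Scope fset_scope.
Local Open Scope ring_scope.
Local Open Scope quotient_scope.

Reserved Notation "U ⊗ W" (at level 40, left associativity).

Section QuotientModule.
Variables (F : fieldType) (M : lmodType F).

(* The subspace of M spanned by the vectors satisfying R. *)
Inductive span (R : M -> Prop) : M -> Prop :=
| span_zero : span R 0
| span_cons (a : F) (r x : M) : R r -> span R x -> span R (a *: r + x).

Definition span_pred (R : M -> Prop) : pred M := fun x => `[< span R x >].

Variable R : M -> Prop.

Lemma span_gen r : R r -> span R r.
Proof.
by move=> Rr; rewrite -[r]scale1r -[_ *: r]addr0; apply: span_cons (span_zero _).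
Qed.

Lemma span_add x y : span R x -> span R y -> span R (x + y).
Proof.
by move=> Rx Ry; elim: Rx => [|a r z Rr _ IH]; rewrite ?add0r // -addrA; apply: span_cons.
Qed.

Lemma span_scale a x : span R x -> span R (a *: x).
Proof.
elim=> [|c r z Rr _ IH]; first by rewrite scaler0; apply: span_zero.
by rewrite scalerDr scalerA; apply: span_cons.
Qed.

Lemma span_pred_zmod_closed : zmod_closed (span_pred R).
Proof.
split=> [|x y]; first by apply/asboolP/span_zero.
move=> /asboolP Rx /asboolP Ry; apply/asboolP.
by rewrite -scaleN1r; apply/span_add/span_scale.
Qed.

HB.instance Definition _ :=
  GRing.isZmodClosed.Build M (span_pred R) span_pred_zmod_closed.

Definition quotm := Quotient.quot (GRing.ZmodClosed.clone M (span_pred R) _).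

HB.instance Definition _ := EqQuotient.on quotm.
HB.instance Definition _ := Choice.on quotm.

(* Each operation below is sealed by its own key: otherwise a failing
   unification between two of them unfolds down to the choice operator. *)
Fact quotm_pi_key : unit. Proof. by []. Qed.
Fact quotm_zero_key : unit. Proof. by []. Qed.
Fact quotm_opp_key : unit. Proof. by []. Qed.
Fact quotm_add_key : unit. Proof. by []. Qed.
Fact quotm_scale_key : unit. Proof. by []. Qed.

Definition quotm_pi : M -> quotm := locked_with quotm_pi_key (\pi_quotm).

Lemma quotm_pi_repr (x : quotm) : quotm_pi (repr x) = x.
Proof. by rewrite /quotm_pi unlock reprK. Qed.

Lemma quotm_piP x y : reflect (quotm_pi x = quotm_pi y) `[< span R (x - y) >].
Proof.
rewrite /quotm_pi unlock; apply: (iffP idP) => h.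
  by apply/eqP; rewrite -Quotient.idealrBE.
have : (x - y) \in span_pred R by rewrite Quotient.idealrBE; apply/eqP.
by [].
Qed.

Lemma quotm_repr_pi x : span R (repr (quotm_pi x) - x).
Proof. by apply/asboolP/quotm_piP/quotm_pi_repr. Qed.

Definition quotm_zero : quotm := locked_with quotm_zero_key (quotm_pi 0).
Definition quotm_opp : quotm -> quotm :=
  locked_with quotm_opp_key (fun x => quotm_pi (- repr x)).
Definition quotm_add : quotm -> quotm -> quotm :=
  locked_with quotm_add_key (fun x y => quotm_pi (repr x + repr y)).
Definition quotm_scale : F -> quotm -> quotm :=
  locked_with quotm_scale_key (fun a x => quotm_pi (a *: repr x)).

Lemma quotm_zero_pi : quotm_zero = quotm_pi 0.
Proof. by rewrite /quotm_zero; case: quotm_zero_key. Qed.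

Lemma quotm_opp_pi x : quotm_opp (quotm_pi x) = quotm_pi (- x).
Proof.
rewrite /quotm_opp unlock; apply/quotm_piP/asboolP.
by rewrite opprK addrC -opprB -scaleN1r; apply/span_scale/quotm_repr_pi.
Qed.

Lemma quotm_add_pi x y : quotm_add (quotm_pi x) (quotm_pi y) = quotm_pi (x + y).
Proof.
rewrite /quotm_add unlock; apply/quotm_piP/asboolP; rewrite opprD addrACA.
by apply: span_add; apply: quotm_repr_pi.
Qed.

Lemma quotm_scale_pi a x : quotm_scale a (quotm_pi x) = quotm_pi (a *: x).
Proof.
rewrite /quotm_scale unlock; apply/quotm_piP/asboolP; rewrite -scalerBr.
by apply/span_scale/quotm_repr_pi.
Qed.

Fact quotm_addA : associative quotm_add.
Proof.
move=> x y z; rewrite -[x]quotm_pi_repr -[y]quotm_pi_repr -[z]quotm_pi_repr.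
by rewrite !quotm_add_pi addrA.
Qed.

Fact quotm_addC : commutative quotm_add.
Proof.
move=> x y; rewrite -[x]quotm_pi_repr -[y]quotm_pi_repr.
by rewrite !quotm_add_pi addrC.
Qed.

Fact quotm_add0 : left_id quotm_zero quotm_add.
Proof.
by move=> x; rewrite -[x]quotm_pi_repr quotm_zero_pi quotm_add_pi add0r.
Qed.

Fact quotm_addN : left_inverse quotm_zero quotm_opp quotm_add.
Proof.
move=> x; rewrite -[x]quotm_pi_repr quotm_opp_pi quotm_add_pi.
by rewrite quotm_zero_pi addNr.
Qed.

HB.instance Definition _ :=
  GRing.isZmodule.Build quotm quotm_addA quotm_addC quotm_add0 quotm_addN.

Lemma quotm_piD x y : quotm_pi (x + y) = quotm_pi x + quotm_pi y.
Proof. by rewrite -quotm_add_pi. Qed.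

Fact quotm_scaleA a b x : quotm_scale a (quotm_scale b x) = quotm_scale (a * b) x.
Proof. by rewrite -[x]quotm_pi_repr !quotm_scale_pi scalerA. Qed.

Fact quotm_scale1 : left_id 1 quotm_scale.
Proof. by move=> x; rewrite -[x]quotm_pi_repr quotm_scale_pi scale1r. Qed.

Fact quotm_scaleDr : right_distributive quotm_scale +%R.
Proof.
move=> a x y; rewrite -[x]quotm_pi_repr -[y]quotm_pi_repr -quotm_piD.
by rewrite !quotm_scale_pi scalerDr quotm_piD.
Qed.

Fact quotm_scaleDl x : {morph quotm_scale^~ x : a b / a + b}.
Proof. by move=> a b; rewrite -[x]quotm_pi_repr !quotm_scale_pi scalerDl quotm_piD. Qed.

HB.instance Definition _ := GRing.Zmodule_isLmodule.Build F quotm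
  quotm_scaleA quotm_scale1 quotm_scaleDr quotm_scaleDl.

Fact quotm_pi_is_linear : linear quotm_pi.
Proof. by move=> a x y; rewrite quotm_piD -quotm_scale_pi. Qed.

HB.instance Definition _ := GRing.isLinear.Build F M quotm _ quotm_pi quotm_pi_is_linear.

End QuotientModule.

Section MalgLift.
Variables (F : fieldType) (K : choiceType) (X : lmodType F) (f : K -> X).

Definition malg_lift (g : {malg F[K]}) : X := \sum_(k <- msupp g) g@_k *: f k.

Lemma malg_liftEw (d : {fset K}) g : msupp g `<=` d ->
  malg_lift g = \sum_(k <- d) g@_k *: f k.
Proof.
move=> le; rewrite /malg_lift (big_fset_incl _ le) // => x xd /mcoeff_outdom ->.
by rewrite scale0r.
Qed.

Lemma malg_lift_is_linear : linear malg_lift.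
Proof.
move=> a x y; set d := msupp x `|` msupp y.
have dx : msupp x `<=` d by apply: fsubsetUl.
have dy : msupp y `<=` d by apply: fsubsetUr.
have dxy : msupp (a *: x + y) `<=` d.
  by apply: fsubset_trans (msuppD_le _ _) _; apply: fsetSU; apply: msuppZ_le.
rewrite (malg_liftEw dx) (malg_liftEw dy) (malg_liftEw dxy) scaler_sumr -big_split.
by apply: eq_bigr => k _; rewrite mcoeffD mcoeffZ scalerDl scalerA.
Qed.

HB.instance Definition _ :=
  GRing.isLinear.Build F {malg F[K]} X _ malg_lift malg_lift_is_linear.

Lemma malg_liftU k : malg_lift << k >> = f k.
Proof. by rewrite (malg_liftEw msuppU_le) big_seq_fset1 mcoeffUU scale1r. Qed.

End MalgLift.

Section Tensor.
Variables (F : fieldType) (U W : lmodType F).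

Inductive tensor_rel : {malg F[(U * W)%type]} -> Prop :=
| tensor_rel_l a u u' w :
    tensor_rel (<< (a *: u + u', w) >> - a *: << (u, w) >> - << (u', w) >>)
| tensor_rel_r a u w w' :
    tensor_rel (<< (u, a *: w + w') >> - a *: << (u, w) >> - << (u, w') >>).

Definition tensor : lmodType F := quotm tensor_rel.

Fact tens_key : unit. Proof. by []. Qed.

Definition tens : U -> W -> tensor :=
  locked_with tens_key (fun u w => quotm_pi tensor_rel << (u, w) >>).

(* The linear map induced by f; meaningful when f is bilinear (tlift_tens). *)
Definition tlift (X : lmodType F) (f : U -> W -> X) (t : tensor) : X :=
  malg_lift (fun k => f k.1 k.2) (repr (t : quotm tensor_rel)).

Definition is_bilinear (X : lmodType F) (f : U -> W -> X) : Prop :=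
  (forall w, linear (f^~ w)) /\ (forall u, linear (f u)).

Lemma tens_bilinear : is_bilinear tens.
Proof.
rewrite /tens unlock; split=> [w a u u'|u a w w']; rewrite -linearZ -linearD;
  apply/quotm_piP/asboolP/span_gen; rewrite opprD addrA.
- exact: tensor_rel_l.
- exact: tensor_rel_r.
Qed.

Section Lift.
Variables (X : lmodType F) (f : U -> W -> X) (hf : is_bilinear f).
Local Notation lf := (malg_lift (fun k : (U * W)%type => f k.1 k.2)).

Lemma tlift_pi x : tlift f (quotm_pi tensor_rel x) = lf x.
Proof.
case: hf => hl hr.
have lf0 z : span tensor_rel z -> lf z = 0.
  elim=> [|a r z' Rr _ IH]; first by rewrite linear0.
  rewrite linearP /= IH addr0 (_ : lf r = 0) ?scaler0 //.
  by case: Rr => [c u u' w|c u w w']; rewrite !linearB linearZ /= !malg_liftU /=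
    ?(hl w) ?(hr u) addrAC addrK subrr.
apply/eqP; rewrite -subr_eq0 -linearB; apply/eqP/lf0/asboolP/quotm_piP.
exact: quotm_pi_repr.
Qed.

Lemma tlift_is_linear : linear (tlift f).
Proof.
move=> a x y; rewrite -[x]quotm_pi_repr -[y]quotm_pi_repr.
by rewrite -linearZ -linearD !tlift_pi linearP.
Qed.

Lemma tlift_tens u w : tlift f (tens u w) = f u w.
Proof. by rewrite /tens unlock tlift_pi malg_liftU. Qed.

End Lift.
End Tensor.

Notation "U ⊗ W" := (tensor U%type W%type) : type_scope.
Notation "u ⊗ w" := (tens u w) : ring_scope.

Section TensorMaps.
Variable F : fieldType.

Definition tmap (U U' W W' : lmodType F) (f : U -> U') (g : W -> W') :
  U ⊗ W -> U' ⊗ W' := tlift (fun u w => f u ⊗ g w).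

Definition tassoc (U W X : lmodType F) : (U ⊗ W) ⊗ X -> U ⊗ (W ⊗ X) :=
  tlift (fun t x => tlift (fun u w => u ⊗ (w ⊗ x)) t).

Definition tassoc_inv (U W X : lmodType F) : U ⊗ (W ⊗ X) -> (U ⊗ W) ⊗ X :=
  tlift (fun u t => tlift (fun w x => (u ⊗ w) ⊗ x) t).

(* id ⊗ f ⊗ id on the fourth tensor power, bracketed as (U ⊗ U) ⊗ (U ⊗ U). *)
Definition tmid (U : lmodType F) (f : U ⊗ U -> U ⊗ U)
    (t : (U ⊗ U) ⊗ (U ⊗ U)) : (U ⊗ U) ⊗ (U ⊗ U) :=
  tassoc_inv
    (tmap id (fun s => tassoc (tmap f id (tassoc_inv s))) (tassoc t)).

End TensorMaps.

Lemma malg_scaleAr (F : fieldType) (M : monomType) (a : F) (x y : {malg F[M]}) :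
  a *: (x * y) = x * (a *: y).
Proof.
apply/malgP => k; rewrite [LHS]mcoeffZ [X in _ * X]mcoeffMl.
rewrite [RHS](mcoeffMlw k (fsubset_refl _) (msuppZ_le a y)).
rewrite mulr_sumr; apply: eq_bigr => i _; rewrite mulr_sumr.
by apply: eq_bigr => j _; rewrite mcoeffZ mulrnAr mulrCA.
Qed.

Section ExteriorAlgebra.
Variables (F : fieldType) (V : lmodType F).

(* The free associative algebra on the underlying set of V. *)
Local Notation free_alg := {malg F[{fmonom V}]}.

Definition free_gen (v : V) : free_alg := << fmu v >>.

(* Linearity of v |-> free_gen v (so that the quotient by these relators alone
   is the tensor algebra of V), and v ^+ 2 = 0. *)
Inductive ext_rel : free_alg -> Prop :=
| ext_rel_lin a u v :
    ext_rel (free_gen (a *: u + v) - a *: free_gen u - free_gen v)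
| ext_rel_sqr v : ext_rel (free_gen v * free_gen v).

Inductive ext_ideal : free_alg -> Prop :=
| ext_ideal_intro x r y : ext_rel r -> ext_ideal (x * r * y).

Definition ext_quot := quotm ext_ideal.

HB.instance Definition _ := GRing.Lmodule.on ext_quot.
HB.instance Definition _ := EqQuotient.on ext_quot.

Local Notation pi := (quotm_pi ext_ideal).

Lemma ext_spanMl z x : span ext_ideal x -> span ext_ideal (z * x).
Proof.
elim=> [|a _ w [s r t Rr] _ IH]; first by rewrite mulr0; apply: span_zero.
rewrite mulrDr -malg_scaleAr; apply: span_cons => //.
by rewrite !mulrA; apply: ext_ideal_intro.
Qed.

Lemma ext_spanMr z x : span ext_ideal x -> span ext_ideal (x * z).
Proof.
elim=> [|a _ w [s r t Rr] _ IH]; first by rewrite mul0r; apply: span_zero.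
rewrite mulrDl -scalerAl; apply: span_cons => //.
by rewrite -(mulrA (s * r)); apply: ext_ideal_intro.
Qed.

Lemma ext_span_mul (x x' y y' : free_alg) :
  span ext_ideal (x' - x) -> span ext_ideal (y' - y) ->
  span ext_ideal (x' * y' - x * y).
Proof.
move=> hx hy; have -> : x' * y' - x * y = x' * (y' - y) + (x' - x) * y.
  by rewrite mulrBr mulrBl addrA subrK.
by apply: span_add; [apply: ext_spanMl|apply: ext_spanMr].
Qed.

Fact ext_one_key : unit. Proof. by []. Qed.
Fact ext_mul_key : unit. Proof. by []. Qed.

Definition ext_one : ext_quot := locked_with ext_one_key (pi 1).
Definition ext_mul : ext_quot -> ext_quot -> ext_quot :=
  locked_with ext_mul_key (fun x y => pi (repr x * repr y)).

Lemma ext_one_pi : ext_one = pi 1.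
Proof. by rewrite /ext_one; case: ext_one_key. Qed.

Lemma ext_mul_pi (x y : free_alg) : ext_mul (pi x) (pi y) = pi (x * y).
Proof.
rewrite /ext_mul unlock; apply/quotm_piP/asboolP.
by apply: ext_span_mul; apply: quotm_repr_pi.
Qed.

Fact ext_mulA : associative ext_mul.
Proof.
move=> x y z; rewrite -[x]quotm_pi_repr -[y]quotm_pi_repr -[z]quotm_pi_repr.
by rewrite !ext_mul_pi mulrA.
Qed.

Fact ext_mul1 : left_id ext_one ext_mul.
Proof. by move=> x; rewrite -[x]quotm_pi_repr ext_one_pi ext_mul_pi mul1r. Qed.

Fact ext_mulr1 : right_id ext_one ext_mul.
Proof. by move=> x; rewrite -[x]quotm_pi_repr ext_one_pi ext_mul_pi mulr1. Qed.

Fact ext_mulDl : left_distributive ext_mul +%R.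
Proof.
move=> x y z; rewrite -[x]quotm_pi_repr -[y]quotm_pi_repr -[z]quotm_pi_repr.
by rewrite -quotm_piD !ext_mul_pi mulrDl quotm_piD.
Qed.

Fact ext_mulDr : right_distributive ext_mul +%R.
Proof.
move=> x y z; rewrite -[x]quotm_pi_repr -[y]quotm_pi_repr -[z]quotm_pi_repr.
by rewrite -quotm_piD !ext_mul_pi mulrDr quotm_piD.
Qed.

Fact ext_one_neq0 : ext_one != 0.
Proof.
apply/eqP; rewrite ext_one_pi -[RHS](linear0 pi) => /quotm_piP/asboolP; rewrite subr0 => h.
have eps_gen v : (free_gen v)@_mone = 0.
  by rewrite mcoeffU (_ : (_ == _) = false) // fmP fmU fm1.
have eps0 x : span ext_ideal x -> x@_mone = 0.
  elim=> [|a _ w [s r t Rr] _ IH]; first exact: mcoeff0.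
  rewrite mcoeffD mcoeffZ IH !rmorphM /= (_ : r@_mone = 0) ?(mulr0, mul0r, addr0) //.
  case: Rr => [c u v|v]; last by rewrite rmorphM /= eps_gen mul0r.
  by rewrite !mcoeffB mcoeffZ !eps_gen mulr0 !subr0.
by have := eps0 _ h; rewrite mcoeff1 eqxx => /eqP; rewrite oner_eq0.
Qed.

HB.instance Definition _ := GRing.Zmodule_isNzRing.Build ext_quot
  ext_mulA ext_mul1 ext_mulr1 ext_mulDl ext_mulDr ext_one_neq0.

Fact ext_scaleAl (a : F) (x y : ext_quot) : a *: ext_mul x y = ext_mul (a *: x) y.
Proof.
rewrite -[x]quotm_pi_repr -[y]quotm_pi_repr ext_mul_pi.
by rewrite -[a *: _]linearZ -[a *: _]linearZ ext_mul_pi scalerAl.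
Qed.

Fact ext_scaleAr (a : F) (x y : ext_quot) : a *: ext_mul x y = ext_mul x (a *: y).
Proof.
rewrite -[x]quotm_pi_repr -[y]quotm_pi_repr ext_mul_pi.
by rewrite -[a *: _]linearZ -[a *: _]linearZ ext_mul_pi malg_scaleAr.
Qed.

HB.instance Definition _ := GRing.Lmodule_isLalgebra.Build F ext_quot ext_scaleAl.
HB.instance Definition _ := GRing.Lalgebra_isAlgebra.Build F ext_quot ext_scaleAr.

Definition exterior : algType F := ext_quot.

Fact ext_in_key : unit. Proof. by []. Qed.

Definition ext_in : V -> exterior :=
  locked_with ext_in_key (fun v => pi (free_gen v)).

Lemma ext_in_is_linear : linear ext_in.
Proof.
rewrite /ext_in unlock => a u v; apply: etrans (quotm_pi_is_linear _ a _ _).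
apply/quotm_piP/asboolP/span_gen; rewrite opprD addrA.
by rewrite -[X in ext_ideal X]mul1r -[X in ext_ideal X]mulr1; apply/ext_ideal_intro/ext_rel_lin.
Qed.

HB.instance Definition _ := GRing.isLinear.Build F V exterior _ ext_in ext_in_is_linear.

Lemma ext_in_sqr v : ext_in v * ext_in v = 0.
Proof.
rewrite /ext_in unlock; apply: etrans (ext_mul_pi _ _) _; rewrite -[RHS](linear0 pi).
apply/quotm_piP/asboolP/span_gen; rewrite subr0.
by rewrite -[X in ext_ideal X]mul1r -[X in ext_ideal X]mulr1; apply/ext_ideal_intro/ext_rel_sqr.
Qed.

Definition ext_nabla : exterior ⊗ exterior -> exterior := tlift *%R.

End ExteriorAlgebra.

Arguments ext_in {F V} v.
Arguments ext_nabla {F V} t.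

Section Braiding.
Variables (K : fieldType) (V : lmodType K) (d : Order.disp_t) (B : orderType d).
Variables (b : B -> V) (p : K).

Definition is_basis : Prop :=
  forall v : V, exists! c : {malg K[B]}, v = \sum_(x <- msupp c) c@_x *: b x.

Definition is_tau (tau : V ⊗ V -> V ⊗ V) : Prop :=
  forall x y : B,
    tau (b x ⊗ b y) =
      if x == y then - (b x ⊗ b y)
      else if (y < x)%O then - (1 - p) *: (b x ⊗ b y) - (b y ⊗ b x)
      else - p *: (b y ⊗ b x).

Local Notation L := (exterior V).

Record is_braiding (tau : V ⊗ V -> V ⊗ V) (T : L ⊗ L -> L ⊗ L) : Prop := {
  braiding_gen : forall t : V ⊗ V,
    T (tmap ext_in ext_in t) = tmap ext_in ext_in (tau t);
  braiding_1l : forall x : L, T (1 ⊗ x) = x ⊗ 1;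
  braiding_1r : forall x : L, T (x ⊗ 1) = 1 ⊗ x;
  braiding_mul : forall t : (L ⊗ L) ⊗ (L ⊗ L),
    T (tmap ext_nabla ext_nabla t) =
    tmap ext_nabla ext_nabla (tmid T (tmap T T (tmid T t)))
}.

Definition monom (E : {fset B}) : L := \prod_(e <- sort <=%O E) ext_in (b e).

Definition theta (A C : {fset B}) : nat :=
  (\sum_(a <- A) \sum_(c <- C) (c < a)%O)%N.

(* E' = exchange E G H and F' = exchange F H G. *)
Definition exchange (E G H : {fset B}) : {fset B} := (E `\` G) `|` H.

(* s G H stands for s_{E,G;F,H}; for k > #|` E| there is no G. *)
Definition braiding_expansion (T : L ⊗ L -> L ⊗ L) (E F : {fset B})
    (s : {fset B} -> {fset B} -> K) : Prop :=
  T (monom E ⊗ monom F) =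
  (-1) ^+ (#|` E| * #|` F|) *:
    \sum_(0 <= k < #|` E|.+1)
      \sum_(G <- fpowerset (E `\` F) | #|` G| == k)
        \sum_(H <- fpowerset (F `\` E) | #|` H| == k)
          s G H *: (monom (exchange F H G) ⊗ monom (exchange E G H)).

Definition alpha (G H : {fset B}) : K :=
  \prod_(g <- G) (p ^ ((theta [fset g] H)%:Z - (theta [fset g] G)%:Z) - 1).

Definition beta (E G F H : {fset B}) : K :=
  let E' := exchange E G H in
  let F' := exchange F H G in
  let C := E `&` F in
  let Fdot := (F `\` E) `\` H in
  (-1) ^+ (theta F E + theta F' E')
  * p ^+ (theta (G `|` C) E + theta Fdot E')
  * alpha G H.

End Braiding.

(* Main.v *)
Require Import Defs.
From HB Require Import structures.
From mathcomp Require Import all_boot all_order all_algebra zify ring.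
From mathcomp Require Import finmap boolp monalg.

(* The compatibility of the braiding T with the product gives
   T(x y ⊗ z) = (id ⊗ ∇)(T ⊗ id)(x ⊗ T(y ⊗ z)) and its mirror image, so T is
   determined by its values on f_e ⊗ f_F, in which f_e may be swapped with at
   most one smaller f_h.  Adding a new least element e to E gives a recursion for
   the coefficient of f_A ⊗ f_D in T(f_E ⊗ f_F): either e moves to D, or it moves
   to A and replaces there some h < e, which moves to D.  The formula for beta
   satisfies it: the pair (G, H) is recovered as (A \ F, F \ A), the factor
   p^theta(G ⊔ C, E) p^theta(Fdot, D) is p^theta(A ∩ E, E) p^theta(A \ E, D), and
   the terms for the various h telescope,
   sum_(h in D, h < e) (1 - p) p^theta({h}, D) = 1 - p^theta({e}, D),
   which cancels the term p^theta({e}, D) if e is in F, and produces the factor of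
   alpha at e otherwise.  The coefficients are well defined since the monomials
   form a basis: the exterior algebra acts on the free module on finite subsets of
   B, and f_E maps the empty set to E. *)

Set Implicit Arguments.
Unset Strict Implicit.
Unset Printing Implicit Defensive.

Import Order.TTheory GRing.Theory.

Local Open Scope fset_scope.
Local Open Scope ring_scope.

(** * Linear maps on tensor products *)

Section TensorLinear.
Variable F : fieldType.
Implicit Types U W X Y : lmodType F.

Lemma malg_ext (I : choiceType) X (f g : {linear {malg F[I]} -> X}) :
  (forall i, f << i >> = g << i >>) -> f =1 g.
Proof.
move=> fg x; rewrite [x]monalgE !raddf_sum; apply: eq_bigr => i _ /=.
have -> : << x@_i *g i >> = x@_i *: << i >> :> {malg F[I]}.
  by apply/malgP => j; rewrite mcoeffZ !mcoeffU mulrnAr mulr1.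
by rewrite !linearZ /= fg.
Qed.

(** A tensor is the class of a formal combination of pairs, and a linear map on such combinations is
    determined by its values on the pairs. *)
Lemma tensor_ext U W X (f g : {linear (U ⊗ W)%type -> X}) :
  (forall u w, f (u ⊗ w) = g (u ⊗ w)) -> f =1 g.
Proof.
move=> fg t; rewrite -[t]quotm_pi_repr.
apply: (@malg_ext _ _ (f \o quotm_pi (@tensor_rel F U W))
                      (g \o quotm_pi (@tensor_rel F U W))) => -[u w] /=.
by have := fg u w; rewrite /tens unlock.
Qed.

Lemma tmap_bilinear U U' W W' (f : {linear U -> U'}) (g : {linear W -> W'}) :
  is_bilinear (fun u w => f u ⊗ g w).
Proof.
have [hl hr] := @tens_bilinear F U' W'.
by split=> [w a x y|u a x y]; rewrite linearP ?hl ?hr.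
Qed.

Lemma tmapE U U' W W' (f : {linear U -> U'}) (g : {linear W -> W'}) u w :
  tmap f g (u ⊗ w) = f u ⊗ g w.
Proof. exact: (tlift_tens (tmap_bilinear f g)). Qed.

HB.instance Definition _ U U' W W' (f : {linear U -> U'}) (g : {linear W -> W'}) :=
  GRing.isLinear.Build F (U ⊗ W)%type (U' ⊗ W')%type _ (tmap f g)
    (tlift_is_linear (tmap_bilinear f g)).

HB.instance Definition _ U W (u : U) := GRing.isLinear.Build F W (U ⊗ W)%type _
  (tens u) ((@tens_bilinear F U W).2 u).

Definition tensr U W (w : W) (u : U) : U ⊗ W := u ⊗ w.

HB.instance Definition _ U W (w : W) := GRing.isLinear.Build F U (U ⊗ W)%type _
  (tensr w) ((@tens_bilinear F U W).1 w).

(** Linearity in [x] reduces to pure tensors, because both sides of the identity are linear in the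
    tensor argument. *)
Lemma tlift_bilinear U W X (Y : lmodType F) (f : U -> W -> X -> Y) :
  (forall x, is_bilinear (fun u w => f u w x)) ->
  (forall u w, linear (f u w)) ->
  is_bilinear (fun t x => tlift (fun u w => f u w x) t : Y).
Proof.
move=> hb hl; split=> [x|t a x y]; first exact: tlift_is_linear.
pose mk z := GRing.isLinear.Build F (U ⊗ W)%type Y _ _ (tlift_is_linear (hb z)).
pose lin z : {linear (U ⊗ W)%type -> Y} := HB.pack (tlift (fun u w => f u w z)) (mk z).
have := @tensor_ext _ _ _ (lin (a *: x + y)) (a \*: lin x \+ lin y).
by apply=> u w /=; rewrite !tlift_tens ?hl.
Qed.

Lemma tassoc_inner_bilinear U W X (x : X) :
  is_bilinear (fun (u : U) (w : W) => u ⊗ (w ⊗ x)).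
Proof.
split=> [w a u u'|u a w w']; first by rewrite (tens_bilinear _ _).1.
by rewrite (tens_bilinear _ _).1 (tens_bilinear _ _).2.
Qed.

Lemma tassoc_bilinear U W X :
  is_bilinear (fun t (x : X) => tlift (fun (u : U) (w : W) => u ⊗ (w ⊗ x)) t).
Proof.
apply: tlift_bilinear => [x|u w a x x']; first exact: tassoc_inner_bilinear.
by rewrite !linearP.
Qed.

Lemma tassocE U W X (u : U) (w : W) (x : X) :
  tassoc ((u ⊗ w) ⊗ x) = u ⊗ (w ⊗ x).
Proof.
rewrite /tassoc (tlift_tens (@tassoc_bilinear U W X)).
exact: (tlift_tens (tassoc_inner_bilinear _ _ x)).
Qed.

HB.instance Definition _ U W X :=
  GRing.isLinear.Build F ((U ⊗ W) ⊗ X)%type (U ⊗ (W ⊗ X))%type _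
    (@tassoc F U W X) (tlift_is_linear (@tassoc_bilinear U W X)).

Lemma tassoc_inv_inner_bilinear U W X (u : U) :
  is_bilinear (fun (w : W) (x : X) => (u ⊗ w) ⊗ x).
Proof.
split=> [x a w w'|w a x x']; last by rewrite linearP.
by rewrite linearP (tens_bilinear _ _).1.
Qed.

Lemma tassoc_inv_bilinear U W X :
  is_bilinear (fun (u : U) t => tlift (fun (w : W) (x : X) => (u ⊗ w) ⊗ x) t).
Proof.
have h : is_bilinear (fun t (u : U) => tlift (fun (w : W) (x : X) => (u ⊗ w) ⊗ x) t).
  apply: tlift_bilinear => [u|w x a u u']; first exact: tassoc_inv_inner_bilinear.
  by rewrite !(tens_bilinear _ _).1.
by case: h => hl hr; split=> [t|u]; [apply: hr|apply: hl].
Qed.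

Lemma tassoc_invE U W X (u : U) (w : W) (x : X) :
  tassoc_inv (u ⊗ (w ⊗ x)) = (u ⊗ w) ⊗ x.
Proof.
rewrite /tassoc_inv (tlift_tens (@tassoc_inv_bilinear U W X)).
exact: (tlift_tens (tassoc_inv_inner_bilinear _ _ u)).
Qed.

HB.instance Definition _ U W X :=
  GRing.isLinear.Build F (U ⊗ (W ⊗ X))%type ((U ⊗ W) ⊗ X)%type _
    (@tassoc_inv F U W X) (tlift_is_linear (@tassoc_inv_bilinear U W X)).

Section Mid.
Variables (U : lmodType F) (f : {linear (U ⊗ U)%type -> (U ⊗ U)%type}).

(** The inner function of [tmid], as a composite of registered linear maps, so that its linearity is
    inferred. *)
Definition tmid_inner : U ⊗ (U ⊗ U) -> U ⊗ (U ⊗ U) :=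
  @tassoc F U U U \o tmap f idfun \o @tassoc_inv F U U U.

HB.instance Definition _ := GRing.Linear.on tmid_inner.

Lemma tmid_comp t : tmid f t = tassoc_inv (tmap idfun tmid_inner (tassoc t)).
Proof. by []. Qed.

Lemma tmid_is_linear : linear (tmid f).
Proof. by move=> a x y; rewrite !tmid_comp !linearP. Qed.

HB.instance Definition _ :=
  GRing.isLinear.Build F ((U ⊗ U) ⊗ (U ⊗ U))%type ((U ⊗ U) ⊗ (U ⊗ U))%type _
   (tmid f) tmid_is_linear.

Lemma tmidE u x y w : tmid f ((u ⊗ x) ⊗ (y ⊗ w)) =
  tassoc_inv (u ⊗ tassoc (f (x ⊗ y) ⊗ w)).
Proof.
rewrite tmid_comp tassocE tmapE; congr (tassoc_inv (_ ⊗ _)).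
by rewrite -[LHS]/(tassoc (tmap f idfun (tassoc_inv (x ⊗ (y ⊗ w))))) tassoc_invE tmapE.
Qed.

End Mid.
End TensorLinear.

(** * The two hexagon identities *)

Section Hexagons.
Variables (K : fieldType) (V : lmodType K).
Local Notation L := (exterior V).

Definition mull (x y : L) : L := x * y.
Definition mulr (x y : L) : L := y * x.

Lemma mull_is_linear x : linear (mull x).
Proof. by move=> a y z; rewrite /mull mulrDr scalerAr. Qed.

Lemma mulr_is_linear x : linear (mulr x).
Proof. by move=> a y z; rewrite /mulr mulrDl scalerAl. Qed.

HB.instance Definition _ x := GRing.isLinear.Build K L L _ (mull x) (mull_is_linear x).
HB.instance Definition _ x := GRing.isLinear.Build K L L _ (mulr x) (mulr_is_linear x).

Lemma mul_bilinear : is_bilinear (fun x y : L => x * y).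
Proof. by split=> [x|x]; [apply: mulr_is_linear|apply: mull_is_linear]. Qed.

Lemma ext_nablaE (x y : L) : ext_nabla (x ⊗ y) = x * y.
Proof. exact: (tlift_tens mul_bilinear). Qed.

HB.instance Definition _ := GRing.isLinear.Build K (L ⊗ L)%type L _
  (@ext_nabla K V) (tlift_is_linear mul_bilinear).

Variables (tau : V ⊗ V -> V ⊗ V) (T : {linear (L ⊗ L)%type -> (L ⊗ L)%type}).
Variable hT : is_braiding tau T.

(* (id ⊗ ∇)(T ⊗ id)(x ⊗ t) *)
Definition hexl (x : L) (t : L ⊗ L) : L ⊗ L :=
  tmap ext_nabla ext_nabla (tmid T (tmap T T (tassoc_inv (x ⊗ tassoc (t ⊗ 1))))).

Lemma hexl_is_linear x : linear (hexl x).
Proof. by move=> a t u; rewrite /hexl (tens_bilinear _ _).1 !linearP. Qed.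

HB.instance Definition _ x := GRing.isLinear.Build K (L ⊗ L)%type (L ⊗ L)%type _
  (hexl x) (hexl_is_linear x).

Lemma hexlE x y z : hexl x (y ⊗ z) = tmap idfun (mulr z) (T (x ⊗ y)).
Proof.
rewrite /hexl tassocE tassoc_invE tmapE (braiding_1r hT).
(* [T (x ⊗ y)] need not be a pure tensor, so the rest is packaged as a linear map and compared on
   pure tensors, where the remaining crossing, with 1, is a flip. *)
pose f t := tmap (@ext_nabla K V) ext_nabla (tmid T (t ⊗ (1 ⊗ z))).
have fl : linear f by move=> a t u; rewrite /f (tens_bilinear _ _).1 !linearP.
pose lf : {linear (L ⊗ L)%type -> (L ⊗ L)%type} := HB.pack f
  (GRing.isLinear.Build K (L ⊗ L)%type (L ⊗ L)%type _ f fl).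
apply: (@tensor_ext _ _ _ _ lf (tmap idfun (mulr z))) => u w.
rewrite /lf /= /f tmidE (braiding_1r hT) tassocE tassoc_invE tmapE /= !ext_nablaE.
by rewrite mulr1 tmapE.
Qed.

(** Multiplicativity of [T] with 1 as fourth factor; [hexl] has exactly the form that the axiom then
    produces. *)
Lemma braiding_mull x y z : T ((x * y) ⊗ z) = hexl x (T (y ⊗ z)).
Proof.
have := braiding_mul hT ((x ⊗ y) ⊗ (z ⊗ 1)).
by rewrite tmapE /= !ext_nablaE mulr1 tmidE.
Qed.

(* (∇ ⊗ id)(id ⊗ T)(t ⊗ y) *)
Definition hexr (y : L) (t : L ⊗ L) : L ⊗ L :=
  tmap ext_nabla ext_nabla (tmid T (tmap T T (tassoc_inv (1 ⊗ tassoc (t ⊗ y))))).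

Lemma hexr_is_linear y : linear (hexr y).
Proof. by move=> a t u; rewrite /hexr (tens_bilinear _ _).1 !linearP. Qed.

HB.instance Definition _ y := GRing.isLinear.Build K (L ⊗ L)%type (L ⊗ L)%type _
  (hexr y) (hexr_is_linear y).

Lemma hexrE x y z : hexr z (x ⊗ y) = tmap (mull x) idfun (T (y ⊗ z)).
Proof.
rewrite /hexr tassocE tassoc_invE tmapE (braiding_1l hT).
pose f t := tmap (@ext_nabla K V) ext_nabla (tmid T ((x ⊗ 1) ⊗ t)).
have fl : linear f by move=> a t u; rewrite /f !linearP.
pose lf : {linear (L ⊗ L)%type -> (L ⊗ L)%type} := HB.pack f
  (GRing.isLinear.Build K (L ⊗ L)%type (L ⊗ L)%type _ f fl).
apply: (@tensor_ext _ _ _ _ lf (tmap (mull x) idfun)) => u w.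
rewrite /lf /= /f tmidE (braiding_1l hT) tassocE tassoc_invE tmapE /= !ext_nablaE.
by rewrite mul1r tmapE.
Qed.

Lemma braiding_mulr x y z : T (x ⊗ (y * z)) = hexr z (T (x ⊗ y)).
Proof.
have := braiding_mul hT ((1 ⊗ x) ⊗ (y ⊗ z)).
by rewrite tmapE /= !ext_nablaE mul1r tmidE.
Qed.

Section Generators.
Variables (d : Order.disp_t) (B : orderType d) (b : B -> V) (p : K).
Variable htau : is_tau b p tau.
Local Notation e x := (ext_in (b x)).

Lemma braiding_ext_in x y : T (e x ⊗ e y) =
  if x == y then - (e x ⊗ e y)
  else if (y < x)%O then - (1 - p) *: (e x ⊗ e y) - (e y ⊗ e x)
  else - p *: (e y ⊗ e x).
Proof.
rewrite -tmapE (braiding_gen hT) htau.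
by do 2?case: ifP => _; rewrite ?(linearB, linearN, linearZ) /= !tmapE.
Qed.

(** The factor [e y] is crossed first. The summand of [tau] that does not exchange the generators
    leaves [e y], not [e x], to cross [z]. *)
Lemma braiding_gen_mul x y z : T (e x ⊗ (e y * z)) =
  if x == y then - tmap (mull (e x)) idfun (T (e y ⊗ z))
  else if (y < x)%O then - (1 - p) *: tmap (mull (e x)) idfun (T (e y ⊗ z))
    - tmap (mull (e y)) idfun (T (e x ⊗ z))
  else - p *: tmap (mull (e y)) idfun (T (e x ⊗ z)).
Proof.
rewrite braiding_mulr braiding_ext_in -!hexrE.
by do 2?case: ifP => _; rewrite ?(linearB, linearN, linearZ).
Qed.

End Generators.
End Hexagons.

(** * The action of the exterior algebra on finite subsets *)

Section Theta.
Variables (d : Order.disp_t) (B : orderType d).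
Implicit Types (A C D : {fset B}) (x y : B).

Lemma theta0l C : theta fset0 C = 0%N.
Proof. by rewrite /theta big_seq_fset0. Qed.

Lemma theta0r A : theta A fset0 = 0%N.
Proof. by rewrite /theta big1 // => a _; rewrite big_seq_fset0. Qed.

Lemma theta1E x y : theta [fset x] [fset y] = (y < x)%O.
Proof. by rewrite /theta !big_seq_fset1. Qed.

Lemma thetaU1l x A C : x \notin A ->
  theta (x |` A) C = (theta [fset x] C + theta A C)%N.
Proof. by move=> xA; rewrite /theta big_fsetU1 // big_seq_fset1. Qed.

Lemma thetaU1r x A C : x \notin C ->
  theta A (x |` C) = (theta A [fset x] + theta A C)%N.
Proof.
move=> xC; rewrite /theta -big_split; apply: eq_bigr => a _.
by rewrite big_fsetU1 // big_seq_fset1.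
Qed.

Lemma theta_eq0 A C : {in A & C, forall x y, (x <= y)%O} -> theta A C = 0%N.
Proof.
move=> le; rewrite /theta big_seq big1 // => a aA; rewrite big_seq big1 // => c cC.
by rewrite ltNge le.
Qed.

Lemma theta_eqM A C : {in A & C, forall x y, (y < x)%O} ->
  theta A C = (#|` A| * #|` C|)%N.
Proof.
move=> lt; rewrite /theta big_seq (eq_bigr (fun=> #|` C|)).
  by rewrite -big_seq big_const_seq count_predT iter_addn addn0 mulnC.
move=> a aA; rewrite big_seq (eq_bigr (fun=> 1%N)) => [|c cC]; last by rewrite lt.
by rewrite -big_seq big_const_seq count_predT iter_addn addn0 mul1n.
Qed.

(** A new least element becomes the leftmost factor of the ordered monomial, so this induction
    follows the structure of [monom]. *)
Lemma fset_min_ind (P : {fset B} -> Prop) : P fset0 ->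
  (forall x A, {in A, forall y, (x < y)%O} -> P A -> P (x |` A)) -> forall A, P A.
Proof.
move=> P0 PS A; have [s] : exists s, s = sort <=%O A by eexists.
have: sorted <%O (sort <=%O A) by rewrite sort_lt_sorted fset_uniq.
move=> + Es; rewrite -Es.
have: A =i s by move=> x; rewrite Es mem_sort.
elim: s A {Es} => [|x s IH] A As.
  by move=> _; rewrite (_ : A = fset0) //; apply/fsetP => x; rewrite As.
rewrite /= lt_path_sortedE => /andP[/allP xs ss].
rewrite (_ : A = x |` [fset y in s]).
  by apply: PS => [y|]; [rewrite inE; apply: xs|apply: IH => // y; rewrite inE].
by apply/fsetP => y; rewrite As !inE.
Qed.


Lemma fsetU1I x A C : (x |` A) `&` C = if x \in C then x |` (A `&` C) else A `&` C.
Proof.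
case: ifP => xC; apply/fsetP => y; rewrite !inE; case: (eqVneq y x) => [->|] //=;
by rewrite xC andbF.
Qed.

Lemma fsetU1D x A C : (x |` A) `\` C = if x \in C then A `\` C else x |` (A `\` C).
Proof.
case: ifP => xC; apply/fsetP => y; rewrite !inE; case: (eqVneq y x) => [->|] //=;
  by rewrite xC ?andbF.
Qed.

Lemma thetaIDl A C D : theta A D = (theta (A `&` C) D + theta (A `\` C) D)%N.
Proof.
elim/fset_min_ind: A => [|x A xA IH]; first by rewrite fset0I fset0D !theta0l.
have xnA : x \notin A by apply/negP => /xA; rewrite ltxx.
rewrite thetaU1l // IH fsetU1I fsetU1D; case: ifP => xC.
  by rewrite thetaU1l ?addnA // in_fsetI (negPf xnA).
by rewrite [in RHS]thetaU1l 1?addnCA // in_fsetD (negPf xnA) andbF.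
Qed.

Lemma thetaIDr A C D : theta D A = (theta D (A `&` C) + theta D (A `\` C))%N.
Proof.
elim/fset_min_ind: A => [|x A xA IH]; first by rewrite fset0I fset0D !theta0r.
have xnA : x \notin A by apply/negP => /xA; rewrite ltxx.
rewrite thetaU1r // IH fsetU1I fsetU1D; case: ifP => xC.
  by rewrite thetaU1r ?addnA // in_fsetI (negPf xnA).
by rewrite [in RHS]thetaU1r 1?addnCA // in_fsetD (negPf xnA) andbF.
Qed.

Lemma thetaUIr A C D :
  (theta D (A `|` C) + theta D (A `&` C) = theta D A + theta D C)%N.
Proof.
rewrite (thetaIDr (A `|` C) A) (thetaIDr C A) [C `&` A]fsetIC.
rewrite (_ : (A `|` C) `&` A = A); last by rewrite fsetIC fsetKU.
rewrite (_ : (A `|` C) `\` A = C `\` A); last by rewrite fsetDUl fsetDv fset0U.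
by rewrite -!addnA [X in (_ + X)%N]addnC.
Qed.

Lemma theta_trichotomy x A :
  (theta [fset x] A + theta A [fset x] + (x \in A) = #|` A|)%N.
Proof.
elim/fset_min_ind: A => [|y A yA IH]; first by rewrite theta0l theta0r cardfs0.
have ynA : y \notin A by apply/negP => /yA; rewrite ltxx.
rewrite thetaU1l // thetaU1r // !theta1E cardfsU1 ynA -IH in_fset1U.
have [->|xy] := eqVneq x y; first by rewrite ltxx (negPf ynA) /=; lia.
by have [yx|yx|yx] := ltgtP y x; [| |rewrite yx eqxx in xy]; rewrite /= ?yx; lia.
Qed.

(** In increasing order the elements [h] of [A] have ranks [theta [fset h] A] equal to 0, 1, 2 and
    so on, and those below [e] come first; the sum is geometric. *)
Lemma telescope_theta (R : comNzRingType) (q : R) e A :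
  \sum_(h <- A) (if (h < e)%O then (1 - q) * q ^+ theta [fset h] A else 0) =
  1 - q ^+ theta [fset e] A.
Proof.
elim/fset_min_ind: A => [|x A xA IH]; first by rewrite big_seq_fset0 theta0r expr0 subrr.
have xnA : x \notin A by apply/negP => /xA; rewrite ltxx.
rewrite big_fsetU1 //= thetaU1r // theta1E ltxx (@theta_eq0 [fset x]); last first.
  by move=> _ y /fset1P-> /xA/ltW.
(* Inserting the least element [x] raises every other rank by one, which gives the factor [q]. *)
rewrite (eq_big_seq (fun h => q * if (h < e)%O then (1 - q) * q ^+ theta [fset h] A else 0)).
  rewrite -big_distrr IH /= thetaU1r // theta1E; case: (ltP x e) => xe.
    by rewrite add1n exprS /=; ring.
  rewrite (@theta_eq0 [fset e]) => [|_ y /fset1P-> /xA/ltW]; last exact: le_trans.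
  by rewrite /= add0n expr0; ring.
move=> h /xA xh; case: ifP => _; last by rewrite mulr0.
by rewrite thetaU1r // theta1E xh add1n exprS; ring.
Qed.

End Theta.

Lemma malg_ind (R : fieldType) (I : choiceType) (P : {malg R[I]} -> Prop) :
  P 0 -> (forall (a : R) i x, P x -> P (a *: << i >> + x)) -> forall x, P x.
Proof.
move=> P0 PS x; rewrite [x]monalgE; elim/big_rec: _ => // i y _.
have -> : << x@_i *g i >> = x@_i *: << i >> :> {malg R[I]}.
  by apply/malgP => j; rewrite mcoeffZ !mcoeffU mulrnAr mulr1.
exact: PS.
Qed.

Lemma malg_ext2 (F : fieldType) (I J : choiceType) (X : lmodType F)
    (f g : {malg F[I]} -> {malg F[J]} -> X) :
  is_bilinear f -> is_bilinear g ->
  (forall i j, f << i >> << j >> = g << i >> << j >>) -> forall x y, f x y = g x y.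
Proof.
move=> [fl fr] [gl gr] fg x y.
have f0 z : f 0 z = 0 by have := fl z (-1) 0 0; rewrite !scaleN1r !addNr.
have g0 z : g 0 z = 0 by have := gl z (-1) 0 0; rewrite !scaleN1r !addNr.
have f1 z : f z 0 = 0 by have := fr z (-1) 0 0; rewrite !scaleN1r !addNr.
have g1 z : g z 0 = 0 by have := gr z (-1) 0 0; rewrite !scaleN1r !addNr.
elim/malg_ind: x => [|a i x IH]; first by rewrite f0 g0.
rewrite fl gl IH; congr (_ *: _ + _) => {IH}.
by elim/malg_ind: y => [|c j y IH]; [rewrite f1 g1|rewrite fr gr IH fg].
Qed.

Lemma scaleACA (R : comNzRingType) (X : lmodType R) (a c : R) (m1 n1 m2 n2 : X) :
  c *: (a *: m1 + n1) + (a *: m2 + n2) = a *: (c *: m1 + m2) + (c *: n1 + n2).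
Proof. by rewrite !scalerDr !scalerA mulrC addrACA. Qed.

(** * Wedge operators on the free module over finite subsets *)

Section Wedge.
Variables (K : fieldType) (V : lmodType K) (d : Order.disp_t) (B : orderType d).
Variables (b : B -> V) (hb : is_basis b).
Local Notation M := {malg K[{fset B}]}.
Local Notation L := (exterior V).

(** [is_basis] only asserts that coordinates exist uniquely; [cid] selects them classically, and
    uniqueness makes the selection linear. *)
Definition coord (v : V) : {malg K[B]} := sval (cid (hb v)).

Lemma coordK v : malg_lift b (coord v) = v.
Proof. exact/esym/(svalP (cid (hb v))).1. Qed.

Lemma malg_lift_basis c : coord (malg_lift b c) = c.
Proof. exact: (svalP (cid (hb (malg_lift b c)))).2. Qed.

Lemma coord_is_linear : linear coord.
Proof.
by move=> a u v; rewrite -[RHS]malg_lift_basis linearP /= !coordK.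
Qed.

HB.instance Definition _ := GRing.isLinear.Build K V {malg K[B]} _ coord coord_is_linear.

Lemma coord_basis x : coord (b x) = << x >>.
Proof. by rewrite -{1}[b x](malg_liftU b) malg_lift_basis. Qed.

(** Models left multiplication by [b x] on sorted monomials: the sign moves [x] past the smaller
    elements. *)
Definition wedge_monom x (A : {fset B}) : M :=
  if x \in A then 0 else (-1) ^+ theta [fset x] A *: << x |` A >>.

(* Sealed, as wedge below: otherwise failing unifications unfold the sums. *)
Fact wedge_basis_key : unit. Proof. by []. Qed.

Definition wedge_basis : B -> M -> M :=
  locked_with wedge_basis_key (fun x => malg_lift (wedge_monom x)).

Lemma wedge_basis_is_linear x : linear (wedge_basis x).
Proof. by rewrite /wedge_basis unlock => a m n; rewrite linearP. Qed.

HB.instance Definition _ x :=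
  GRing.isLinear.Build K M M _ (wedge_basis x) (wedge_basis_is_linear x).

Fact wedge_key : unit. Proof. by []. Qed.

Definition wedge : V -> M -> M :=
  locked_with wedge_key (fun v m => malg_lift (wedge_basis ^~ m) (coord v)).

Lemma wedgeE v m : wedge v m = malg_lift (wedge_basis ^~ m) (coord v).
Proof. by rewrite /wedge unlock. Qed.

Lemma wedge_is_linear v : linear (wedge v).
Proof.
move=> a m n; rewrite !wedgeE /malg_lift scaler_sumr -big_split.
by apply: eq_bigr => x _; rewrite linearP scalerDr !scalerA mulrC.
Qed.

HB.instance Definition _ v := GRing.isLinear.Build K M M _ (wedge v) (wedge_is_linear v).

Lemma wedgeDl u v m : wedge (u + v) m = wedge u m + wedge v m.
Proof. by rewrite !wedgeE !linearD. Qed.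

Lemma wedgeZl a v m : wedge (a *: v) m = a *: wedge v m.
Proof. by rewrite !wedgeE !linearZ. Qed.

Lemma wedge_b x m : wedge (b x) m = wedge_basis x m.
Proof. by rewrite wedgeE coord_basis malg_liftU. Qed.

Lemma basis_ind (P : V -> Prop) :
  P 0 -> (forall a x v, P v -> P (a *: b x + v)) -> forall v, P v.
Proof.
move=> P0 PS v; rewrite -[v]coordK; elim/malg_ind: (coord v) => [|a x c IH].
  by rewrite linear0.
by rewrite linearP /= malg_liftU; apply: PS.
Qed.

Lemma wedge_basisU x A : wedge_basis x << A >> = wedge_monom x A.
Proof. by rewrite /wedge_basis unlock malg_liftU. Qed.

Lemma wedge_monom_in x (A : {fset B}) : x \in A -> wedge_monom x A = 0.
Proof. by rewrite /wedge_monom => ->. Qed.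

Lemma wedge_monom_notin x (A : {fset B}) : x \notin A ->
  wedge_monom x A = (-1) ^+ theta [fset x] A *: << x |` A >>.
Proof. by rewrite /wedge_monom => /negPf->. Qed.

Lemma wedge_basis_wedge_monom x y (A : {fset B}) :
  x \in y |` A -> wedge_basis x (wedge_monom y A) = 0.
Proof.
move=> xA; have [yA|yA] := boolP (y \in A); first by rewrite wedge_monom_in ?linear0.
by rewrite wedge_monom_notin // linearZ /= wedge_basisU wedge_monom_in ?scaler0.
Qed.

Lemma wedge_basis_anti x y m :
  wedge_basis x (wedge_basis y m) + wedge_basis y (wedge_basis x m) = 0.
Proof.
elim/malg_ind: m => [|a A m IH]; first by rewrite !linear0 addr0.
rewrite !linearP /= addrACA IH addr0 -scalerDr !wedge_basisU.
apply: etrans (scaler0 _ a); congr (_ *: _).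
have [xA|xA] := boolP (x \in A).
  rewrite (wedge_monom_in xA) linear0 wedge_basis_wedge_monom ?addr0 //.
  by rewrite in_fsetU xA orbT.
have [yA|yA] := boolP (y \in A).
  rewrite (wedge_monom_in yA) linear0 wedge_basis_wedge_monom ?addr0 //.
  by rewrite in_fsetU yA orbT.
have [<-|xy] := eqVneq x y.
  by rewrite wedge_basis_wedge_monom ?fset1U1 ?addr0.
have xyA : x \notin y |` A by rewrite in_fsetU in_fset1 negb_or xy xA.
have yxA : y \notin x |` A by rewrite in_fsetU in_fset1 negb_or eq_sym xy yA.
rewrite (wedge_monom_notin xA) (wedge_monom_notin yA) !linearZ /= !wedge_basisU.
rewrite (wedge_monom_notin xyA) (wedge_monom_notin yxA).
rewrite (thetaU1r _ xA) (thetaU1r _ yA) !theta1E !exprD fsetUCA !scalerA -scalerDl.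
apply: etrans (scale0r _); congr (_ *: _).
(* Both composites reach the same set; exactly one of them inserts the larger element second and
   picks up an extra sign. *)
have -> : (x < y)%O = ~~ (y < x)%O by rewrite -leNgt le_eqVlt (negPf xy).
by case: (y < x)%O => /=; rewrite ?expr0 ?expr1; ring.
Qed.

Lemma wedge_basis_sqr x m : wedge_basis x (wedge_basis x m) = 0.
Proof.
elim/malg_ind: m => [|a A m IH]; first by rewrite !linear0.
by rewrite !linearP /= IH addr0 wedge_basisU wedge_basis_wedge_monom ?scaler0 ?fset1U1.
Qed.

Lemma wedge_anti u v m : wedge u (wedge v m) + wedge v (wedge u m) = 0.
Proof.
have w0 n : wedge 0 n = 0 by rewrite !wedgeE !linear0.
elim/basis_ind: u => [|a x u IHu]; first by rewrite !w0 linear0 addr0.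
rewrite !(wedgeDl, wedgeZl) linearP /= addrACA IHu addr0 -scalerDr.
apply: etrans (scaler0 _ a); congr (_ *: _).
elim/basis_ind: v {IHu} => [|c y v IHv]; first by rewrite !w0 linear0 addr0.
rewrite !(wedgeDl, wedgeZl) linearP /= addrACA IHv addr0 -scalerDr !wedge_b.
by rewrite wedge_basis_anti scaler0.
Qed.

(** Anticommutation alone would not give this in characteristic 2. Squares of basis vectors vanish,
    and the cross terms cancel by [wedge_anti]. *)
Lemma wedge_sqr v m : wedge v (wedge v m) = 0.
Proof.
elim/basis_ind: v => [|a x v IHv]; first by rewrite !wedgeE !linear0.
have bx0 : wedge (b x) (wedge (b x) m) = 0 by rewrite !wedge_b wedge_basis_sqr.
have wE n : wedge (a *: b x + v) n = a *: wedge (b x) n + wedge v n.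
  by rewrite wedgeDl wedgeZl.
rewrite [LHS]wE wE; have := wedge_anti (b x) v m.
have -> : wedge (b x) (a *: wedge (b x) m + wedge v m) = a *: 0 + wedge (b x) (wedge v m).
  by rewrite -bx0 linearP.
have -> : wedge v (a *: wedge (b x) m + wedge v m) = a *: wedge v (wedge (b x) m) + 0.
  by rewrite -[X in _ = _ + X]IHv linearP.
move: (wedge (b x) (wedge v m)) (wedge v (wedge (b x) m)) => m1 m2.
by rewrite scaler0 add0r addr0 -scalerDr => ->; rewrite scaler0.
Qed.

Local Notation free_alg := {malg K[{fmonom V}]}.

Definition ext_act_monom (m : M) (w : {fmonom V}) : M := foldr wedge m (w : seq V).

Fact ext_act_key : unit. Proof. by []. Qed.

Definition ext_act : M -> free_alg -> M :=
  locked_with ext_act_key (fun m => malg_lift (ext_act_monom m)).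

Lemma ext_actU m w : ext_act m << w >> = foldr wedge m (w : seq V).
Proof. by rewrite /ext_act unlock malg_liftU. Qed.

Lemma ext_act_is_linear m : linear (ext_act m).
Proof. by rewrite /ext_act unlock => a x y; rewrite linearP. Qed.

HB.instance Definition _ m :=
  GRing.isLinear.Build K free_alg M _ (ext_act m) (ext_act_is_linear m).

Lemma ext_actP a m n x : ext_act (a *: m + n) x = a *: ext_act m x + ext_act n x.
Proof.
elim/malg_ind: x => [|c w x IH]; first by rewrite !linear0 addr0.
rewrite !(linearP (ext_act _)) /= IH.
have -> : ext_act (a *: m + n) << w >> = a *: ext_act m << w >> + ext_act n << w >>.
  by rewrite !ext_actU; elim: (w : seq V) => //= v s ->; rewrite linearP.
exact: scaleACA.
Qed.

Lemma ext_act_mul m x y : ext_act m (x * y) = ext_act (ext_act m y) x.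
Proof.
pose f u v := ext_act m (u * v); pose g u v := ext_act (ext_act m v) u.
apply: (@malg_ext2 K _ _ _ f g); rewrite /f /g.
- split=> [v a u u'|u a v v']; first by rewrite mulrDl -scalerAl linearP.
  by rewrite mulrDr -malg_scaleAr linearP.
- by split=> [v a u u'|u a v v']; rewrite linearP // ext_actP.
move=> w u; rewrite malgM_def fgmulUU mulr1.
by rewrite !ext_actU fmM foldr_cat.
Qed.

Lemma ext_act_gen m v : ext_act m (free_gen v) = wedge v m.
Proof. by rewrite /free_gen ext_actU fmuE. Qed.

(** [ext_act] is a left action in which the relators kill every vector, hence so does the two-sided
    ideal; the action descends to the exterior algebra. *)
Lemma ext_act_ideal m x : Defs.span (@ext_ideal K V) x -> ext_act m x = 0.
Proof.
elim=> [|a _ y [s r t Rr] _ IH]; first by rewrite linear0.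
rewrite linearP /= IH addr0 !ext_act_mul.
rewrite (_ : ext_act (ext_act m t) r = 0); last first.
  case: Rr => [c u v|v]; last by rewrite ext_act_mul !ext_act_gen wedge_sqr.
  by rewrite !linearB linearZ /= !ext_act_gen wedgeDl wedgeZl addrAC addrK subrr.
by have := ext_actP (-1) 0 0 s; rewrite !scaleN1r !addNr => ->; rewrite scaler0.
Qed.

Local Notation pi := (quotm_pi (@ext_ideal K V)).

(** The orbit map of the empty set; the choice of representative is immaterial by [ext_coord_pi]. It
    turns out to give the coordinates in the monomial basis. *)
Definition ext_coord (x : L) : M := ext_act << fset0 >> (repr (x : ext_quot V)).

Lemma ext_coord_pi x : ext_coord (pi x) = ext_act << fset0 >> x.
Proof.
apply/eqP; rewrite -subr_eq0 -linearB; apply/eqP/ext_act_ideal.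
exact: quotm_repr_pi.
Qed.

Lemma ext_coord_is_linear : linear ext_coord.
Proof.
move=> a x y; rewrite -[x]quotm_pi_repr -[y]quotm_pi_repr.
have -> : a *: pi (repr (x : ext_quot V)) + pi (repr (y : ext_quot V)) =
    pi (a *: repr (x : ext_quot V) + repr (y : ext_quot V)) by rewrite linearP.
by rewrite !ext_coord_pi linearP.
Qed.

HB.instance Definition _ :=
  GRing.isLinear.Build K L M _ ext_coord ext_coord_is_linear.

Lemma ext_coord1 : ext_coord 1 = << fset0 >>.
Proof.
have -> : (1 : L) = pi 1 by apply: ext_one_pi.
by rewrite ext_coord_pi ext_actU fm1.
Qed.

Lemma ext_coord_mul v x : ext_coord (ext_in v * x) = wedge v (ext_coord x).
Proof.
rewrite /ext_in unlock -[x]quotm_pi_repr.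
have -> : (pi (free_gen v) : L) * pi (repr (x : ext_quot V)) =
    pi (free_gen v * repr (x : ext_quot V)).
  exact: ext_mul_pi.
by rewrite !ext_coord_pi ext_act_mul ext_act_gen.
Qed.

Lemma ext_ind (P : L -> Prop) : P 1 -> (forall a x y, P x -> P y -> P (a *: x + y)) ->
  (forall v x, P x -> P (ext_in v * x)) -> forall x, P x.
Proof.
move=> P1 PL PM x; rewrite -[x]quotm_pi_repr; elim/malg_ind: (repr _) => [|a w y IH].
  (* Zero is obtained as -1 times 1 plus 1. *)
  by rewrite linear0; have := PL (-1) _ _ P1 P1; rewrite scaleN1r addNr.
have -> : pi (a *: << w >> + y) = a *: (pi << w >> : L) + pi y.
  by rewrite linearP.
apply: PL => //.
case: w => s; elim: s => [|v s IHs].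
  by rewrite (_ : << _ >> = 1) -?ext_one_pi //; congr << _ >>; apply/val_inj; rewrite /= fm1.
have -> : << FMonom (v :: s) >> = free_gen v * << FMonom s >> :> free_alg.
  by rewrite /free_gen malgM_def fgmulUU mulr1; congr << _ >>; apply/val_inj; rewrite /= fmM fmuE.
rewrite -ext_mul_pi.
have := PM v _ IHs; by rewrite /ext_in unlock.
Qed.

Lemma ext_in_anti u v : ext_in u * ext_in v = - (ext_in v * ext_in u) :> L.
Proof.
apply/eqP; rewrite -subr_eq0 opprK; apply/eqP.
have := ext_in_sqr (u + v); rewrite linearD mulrDl !mulrDr !ext_in_sqr add0r addr0.
by [].
Qed.

End Wedge.

(** * The monomial basis *)

Lemma malg_lift2_bilinear (F : fieldType) (I J : choiceType) (X : lmodType F)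
    (f : I -> J -> X) :
  is_bilinear (fun x y => malg_lift (fun i => malg_lift (f i) y) x).
Proof.
split=> [y|x]; first exact: malg_lift_is_linear.
move=> a y z; have liftE n : malg_lift (fun i => malg_lift (f i) n) x =
  \sum_(i <- msupp x) x@_i *: malg_lift (f i) n by [].
rewrite !liftE scaler_sumr -big_split.
apply: eq_bigr => i _; rewrite linearP scalerDr !scalerA mulrC //.
Qed.

Section MonomialBasis.
Variables (K : fieldType) (V : lmodType K) (d : Order.disp_t) (B : orderType d).
Variables (b : B -> V).
Implicit Types (x y : B) (A C D : {fset B}).
Local Notation L := (exterior V).
Local Notation e x := (ext_in (b x) : L).
Local Notation f A := (monom b A).

Lemma monom0 : f fset0 = 1.
Proof. by rewrite /monom (_ : sort _ _ = [::]) ?big_nil. Qed.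

Lemma monomU1 x A : {in A, forall y, (x < y)%O} -> f (x |` A) = e x * f A.
Proof.
move=> xA; rewrite /monom.
have xnA : x \notin A by apply/negP => /xA; rewrite ltxx.
suff -> : sort <=%O (x |` A) = x :: sort <=%O A by rewrite big_cons.
apply: (@sorted_eq _ <=%O); first exact: le_trans.
- exact: le_anti.
- exact: sort_le_sorted.
- rewrite /= le_path_sortedE sort_le_sorted andbT.
  by apply/allP => y; rewrite mem_sort => /xA/ltW.
apply: uniq_perm; first by rewrite sort_uniq fset_uniq.
  by rewrite /= mem_sort sort_uniq fset_uniq andbT.
by move=> y; rewrite mem_sort !inE mem_sort.
Qed.

(** The generator anticommutes past the smaller factors until it meets its own copy, where the
    square vanishes. *)
Lemma gen_mul_monom_in x A : x \in A -> e x * f A = 0.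
Proof.
elim/fset_min_ind: A x => [|y A yA IH] x; first by rewrite inE.
rewrite in_fset1U (monomU1 yA) mulrA => /orP[/eqP->|xA]; first by rewrite ext_in_sqr mul0r.
by rewrite ext_in_anti mulNr -mulrA IH // mulr0 oppr0.
Qed.

Lemma gen_mul_monom x A : x \notin A ->
  e x * f A = (-1) ^+ theta [fset x] A *: f (x |` A).
Proof.
elim/fset_min_ind: A x => [|y A yA IH] x.
  by move=> _; rewrite theta0r scale1r monomU1 // => z; rewrite inE.
have ynA : y \notin A by apply/negP => /yA; rewrite ltxx.
rewrite in_fset1U negb_or => /andP[xy xA].
have [yx|xy'] := ltP y x; last first.
  have {}xy : (x < y)%O by rewrite lt_neqAle xy.
  rewrite -monomU1 => [|z]; last first.
    by rewrite in_fset1U => /orP[/eqP->//|/yA]; apply: lt_trans.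
  rewrite theta_eq0 ?scale1r // => _ z /fset1P-> .
  by rewrite in_fset1U => /orP[/eqP->|/yA/(lt_trans xy)/ltW//]; apply: ltW.
rewrite monomU1 // mulrA ext_in_anti mulNr -mulrA IH // -scalerAr fsetUCA.
rewrite [in RHS]monomU1 => [|z]; last first.
  by rewrite in_fset1U => /orP[/eqP->//|/yA].
by rewrite thetaU1r // theta1E yx exprD expr1 mulN1r scaleNr.
Qed.

Variable hb : is_basis b.

(** This gives linear independence of the monomials. No sign appears, since each factor is inserted
    below all the previous ones. *)
Lemma ext_coord_monom A : ext_coord hb (f A) = << A >>.
Proof.
elim/fset_min_ind: A => [|x A xA IH]; first by rewrite monom0 ext_coord1.
have xnA : x \notin A by apply/negP => /xA; rewrite ltxx.
rewrite monomU1 // ext_coord_mul IH wedge_b wedge_basisU wedge_monom_notin //.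
by rewrite theta_eq0 ?scale1r // => _ y /fset1P-> /xA/ltW.
Qed.

Lemma malg_lift_wedge v m :
  malg_lift (monom b) (wedge hb v m) = ext_in v * malg_lift (monom b) m :> L.
Proof.
rewrite wedgeE -[in RHS](coordK hb v).
pose g c (n : {malg K[{fset B}]}) :=
  malg_lift (monom b) (malg_lift (fun x => @wedge_basis K d B x n) c).
pose h c (n : {malg K[{fset B}]}) := ext_in (malg_lift b c) * malg_lift (monom b) n : L.
apply: (@malg_ext2 K _ _ _ g h); rewrite /g /h.
- split=> [n|c a n n']; first by move=> a c c'; rewrite !linearP.
  rewrite -linearP; congr (malg_lift (monom b) _).
  rewrite /malg_lift scaler_sumr -big_split; apply: eq_bigr => x _.
  by rewrite linearP scalerDr !scalerA mulrC.
- split=> [n|c] a u v'; first by rewrite !linearP mulrDl scalerAl.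
  by rewrite linearP mulrDr scalerAr.
move=> x A; rewrite !malg_liftU wedge_basisU.
have [xA|xA] := boolP (x \in A).
  by rewrite wedge_monom_in // linear0 gen_mul_monom_in.
by rewrite wedge_monom_notin // linearZ /= malg_liftU gen_mul_monom.
Qed.

(** This says that the monomials span: sending a set to its monomial intertwines [wedge] with left
    multiplication, and vectors generate the algebra. *)
Lemma ext_coordK (z : L) : malg_lift (monom b) (ext_coord hb z) = z.
Proof.
elim/ext_ind: z => [|a y z IHy IHz|v z IH].
- by rewrite ext_coord1 malg_liftU monom0.
- by rewrite !linearP /= IHy IHz.
by rewrite ext_coord_mul malg_lift_wedge IH.
Qed.

Lemma monom_tensor_ext (X : lmodType K) (g h : {linear (L ⊗ L)%type -> X}) :
  (forall A D, g (f A ⊗ f D) = h (f A ⊗ f D)) -> g =1 h.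
Proof.
move=> gh; apply: tensor_ext => u w.
rewrite -[u]ext_coordK -[w]ext_coordK.
pose lift (k : {linear (L ⊗ L)%type -> X}) m n :=
  k (malg_lift (monom b) m ⊗ malg_lift (monom b) n).
have lift_bilinear k : is_bilinear (lift k).
  rewrite /lift; split=> [n|m] a m1 m2; last by rewrite !linearP.
  by rewrite linearP (tens_bilinear _ _).1 linearP.
apply: (@malg_ext2 K _ _ _ (lift g) (lift h)) => // A D.
by rewrite /lift !malg_liftU.
Qed.

Definition pair_coord : L -> L -> {malg K[({fset B} * {fset B})%type]} :=
  fun u w => malg_lift (fun A => malg_lift (fun D => << (A, D) >>) (ext_coord hb w))
                       (ext_coord hb u).

Lemma pair_coord_bilinear : is_bilinear pair_coord.
Proof.
have [hl hr] := malg_lift2_bilinear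
  (fun (A D : {fset B}) => << (A, D) >> : {malg K[({fset B} * {fset B})%type]}).
by split=> [w|u] a u1 u2; rewrite /pair_coord linearP; [apply: hl|apply: hr].
Qed.

Fact coef_key : unit. Proof. by []. Qed.

(** The coordinate functional dual to [f A ⊗ f D], as [coef_monom] confirms. *)
Definition coef : {fset B} -> {fset B} -> L ⊗ L -> K :=
  locked_with coef_key (fun A D t => (tlift pair_coord t)@_(A, D)).

Lemma coef_is_scalar A D : scalar (coef A D).
Proof.
rewrite /coef unlock => a t u.
by rewrite (tlift_is_linear pair_coord_bilinear) mcoeffD mcoeffZ.
Qed.

HB.instance Definition _ A D :=
  GRing.isLinear.Build K (L ⊗ L)%type K *%R (coef A D) (coef_is_scalar A D).

Lemma coef_monom A D A' D' :
  coef A D (f A' ⊗ f D') = ((A' == A) && (D' == D))%:R.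
Proof.
rewrite /coef unlock (tlift_tens pair_coord_bilinear) /pair_coord.
by rewrite !ext_coord_monom !malg_liftU mcoeffU.
Qed.

Lemma coef_inj t u : (forall A D, coef A D t = coef A D u) -> t = u.
Proof.
move=> tu.
pose mt (k : {fset B} * {fset B}) := f k.1 ⊗ f k.2.
pose lin : {linear (L ⊗ L)%type -> {malg K[({fset B} * {fset B})%type]}} :=
  HB.pack (tlift pair_coord) (GRing.isLinear.Build K (L ⊗ L)%type
    {malg K[({fset B} * {fset B})%type]} _ _ (tlift_is_linear pair_coord_bilinear)).
(* Every tensor is rebuilt from its coordinates, so the coordinate map is injective. *)
have linK v : malg_lift mt (lin v) = v.
  apply: (@monom_tensor_ext _ (malg_lift mt \o lin) idfun) => A D /=.
  rewrite (tlift_tens pair_coord_bilinear) /pair_coord !ext_coord_monom.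
  by rewrite !malg_liftU.
suff lin_tu : lin t = lin u by rewrite -[t]linK lin_tu linK.
apply/malgP => -[A D].
by have := tu A D; rewrite /coef unlock.
Qed.

End MonomialBasis.

(** * Braiding a generator past a monomial *)

Lemma tens0l (K : fieldType) (U W : lmodType K) (w : W) : (0 : U) ⊗ w = 0.
Proof. exact: (linear0 (tensr w)). Qed.

Lemma tensZl (K : fieldType) (U W : lmodType K) a (u : U) (w : W) :
  (a *: u) ⊗ w = a *: (u ⊗ w).
Proof. by rewrite -[LHS]/(tensr w (a *: u)) linearZ. Qed.

Section SingleStrand.
Variables (K : fieldType) (V : lmodType K) (d : Order.disp_t) (B : orderType d).
Variables (b : B -> V) (p : K).
Variables (tau : V ⊗ V -> V ⊗ V)
  (T : {linear (exterior V ⊗ exterior V)%type -> (exterior V ⊗ exterior V)%type}).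
Variables (htau : is_tau b p tau) (hT : is_braiding tau T).
Implicit Types (x y c h : B) (A C D F : {fset B}).
Local Notation L := (exterior V).
Local Notation e x := (ext_in (b x) : L).
Local Notation f A := (monom b A).

(** Every crossing falls in the case of [tau] that exchanges the generators with factor [- p]. *)
Lemma braiding_gen_lt c F : {in F, forall y, (c < y)%O} ->
  T (e c ⊗ f F) = (- p) ^+ #|` F| *: (f F ⊗ e c).
Proof.
elim/fset_min_ind: F => [|x F xF IH] cF.
  by rewrite monom0 (braiding_1r hT) cardfs0 expr0 scale1r.
have cx : (c < x)%O by apply: cF; rewrite fset1U1.
have xnF : x \notin F by apply/negP => /xF; rewrite ltxx.
rewrite (monomU1 _ xF) (braiding_gen_mul hT htau) (lt_eqF cx) ltNge (ltW cx) /=.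
rewrite IH => [|y yF]; last by apply: cF; rewrite in_fset1U yF orbT.
by rewrite linearZ /= tmapE /= cardfsU1 xnF scalerA exprS.
Qed.

(** The strand [c] crosses the elements below [h] with factor -1 each and takes the place of [h]
    with factor [- (1 - p)]; then [h] crosses the elements above it with factor [- p] each. Sorting
    [c] past the elements between [h] and [c] gives the remaining sign. A global [(-1) ^+ #|F|] is
    split off. *)
Definition swap_coef c F h : K :=
  (p - 1) * p ^+ theta F [fset h] * (-1) ^+ (theta [fset c] F + theta [fset h] F).

(** If [c] already lies in [F], the left product would contain it twice, so the term is zero. *)
Definition swap_term c F h : L ⊗ L :=
  if (h < c)%O && (c \notin F)
  then swap_coef c F h *: (f (c |` (F `\ h)) ⊗ e h) else 0.

(** Induction on the least element [x]. If [x] is above [c], nothing is replaced; if [x = c], the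
    second copy of [c] crosses the rest. If [x] is below [c], either [c] takes the place of [x],
    which crosses the rest, or [c] crosses [x] and the induction hypothesis applies. *)
Lemma braiding_gen_monom c F : T (e c ⊗ f F) =
  (-1) ^+ #|` F| *: (p ^+ theta F [fset c] *: (f F ⊗ e c)
                     + \sum_(h <- F) swap_term c F h).
Proof.
elim/fset_min_ind: F => [|x F xF IH].
  rewrite monom0 (braiding_1r hT) cardfs0 theta0l big_seq_fset0 !expr0.
  by rewrite !scale1r addr0.
have xnF : x \notin F by apply/negP => /xF; rewrite ltxx.
rewrite cardfsU1 xnF exprS mulN1r thetaU1l // theta1E.
have [xc|cx|<-{c IH}] := ltgtP x c; last 2 first.
- rewrite braiding_gen_lt => [|y]; last first.
    by rewrite in_fset1U => /orP[/eqP->//|/xF]; apply: lt_trans.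
  rewrite theta_eqM => [|y _ yF /fset1P->]; last by apply/(lt_trans cx)/xF.
  rewrite (big_seq _) big1 => [|h]; last first.
    rewrite in_fset1U /swap_term => hF; rewrite ltNge (ltW _) //.
    by case/orP: hF => [/eqP->//|/xF]; apply: lt_trans.
  rewrite addr0 scalerA cardfsU1 xnF cardfs1 muln1 !add1n !exprS.
  by rewrite [(- p) ^+ #|` F|]exprNn; congr (_ *: _); ring.
- rewrite monomU1 // (braiding_gen_mul hT htau) eqxx braiding_gen_lt //.
  rewrite theta_eqM => [|y _ yF /fset1P->]; last exact: xF.
  rewrite big1 ?addr0; last by move=> h _; rewrite /swap_term fset1U1 andbF.
  by rewrite linearZ /= tmapE /= cardfs1 muln1 [(- p) ^+ _]exprNn scalerA mulNr scaleNr add0n.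
(* Prepending [x] below both [c] and [h] adds one to each of the two sign exponents, so the
   coefficient is unchanged. *)
have mull_swap h : h \in F ->
    tmap (mull (e x)) idfun (swap_term c F h) = swap_term c (x |` F) h.
  move=> hF; rewrite /swap_term in_fset1U (gt_eqF xc) /=.
  case: ifP => [/andP[hc cF]|_]; last by rewrite linear0.
  have xh := xF h hF; rewrite linearZ /= tmapE /= /mull -monomU1 => [|y]; last first.
    by rewrite in_fset1U in_fsetD1 => /orP[/eqP->//|/andP[_ /xF]].
  congr (_ *: (f _ ⊗ _)).
    rewrite /swap_coef thetaU1l // !thetaU1r // !theta1E (lt_gtF xh) xh xc.
    by rewrite !addSn addnS !exprS add0n; ring.
  apply/fsetP => y; rewrite !(in_fset1U, in_fsetD1); case: (eqVneq y x) => [->|//].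
  by rewrite (lt_eqF xh) orbT.
(* This is the replacement of [x] itself; if [c] is in [F], both sides vanish. *)
have mull_new : (1 - p) *: tmap (mull (e c)) idfun ((- p) ^+ #|` F| *: (f F ⊗ e x)) =
    (-1) ^+ #|` F| *: swap_term c (x |` F) x.
  rewrite linearZ /= tmapE /= /mull /swap_term in_fset1U (gt_eqF xc) xc /=.
  have [cF|cF] := boolP (c \in F).
    by rewrite gen_mul_monom_in // tens0l !scaler0.
  rewrite gen_mul_monom // tensZl fsetU1K //.
  rewrite !scalerA /swap_coef thetaU1l // !thetaU1r // !theta1E ltxx xc.
  rewrite (@theta_eqM _ _ F) => [|y _ yF /fset1P->]; last exact: xF.
  rewrite (@theta_eq0 _ _ [fset x]) => [|_ y /fset1P-> /xF/ltW//].
  rewrite cardfs1 muln1 [(- p) ^+ _]exprNn !add0n addn0 add1n exprS; congr (_ *: _); ring.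
rewrite big_fsetU1 // monomU1 // (braiding_gen_mul hT htau) (gt_eqF xc) xc.
rewrite braiding_gen_lt // scaleNr mull_new IH.
have -> : tmap (mull (e x)) idfun ((-1) ^+ #|` F| *: (p ^+ theta F [fset c] *:
      (f F ⊗ e c) + \sum_(h <- F) swap_term c F h)) =
    (-1) ^+ #|` F| *: (p ^+ theta F [fset c] *: (e x * f F ⊗ e c)
      + \sum_(h <- F) swap_term c (x |` F) h).
  rewrite [LHS]linearZ /= [X in _ *: X = _]linearD /= [X in _ *: (X + _) = _]linearZ /=.
  by rewrite tmapE [X in _ *: (_ + X) = _]linear_sum (eq_big_seq _ mull_swap).
by rewrite scaleNr -opprD -scalerDr addrCA.
Qed.

End SingleStrand.

(** * The recursion for the coefficients *)

Section Recursion.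
Variables (K : fieldType) (V : lmodType K) (d : Order.disp_t) (B : orderType d).
Variables (b : B -> V) (hb : is_basis b) (p : K).
Variables (tau : V ⊗ V -> V ⊗ V)
  (T : {linear (exterior V ⊗ exterior V)%type -> (exterior V ⊗ exterior V)%type}).
Variables (htau : is_tau b p tau) (hT : is_braiding tau T).
Implicit Types (c h : B) (A C D F : {fset B}).
Local Notation L := (exterior V).
Local Notation e x := (ext_in (b x) : L).
Local Notation f A := (monom b A).

Lemma monom_tensor_scalar_ext (g h : L ⊗ L -> K) : scalar g -> scalar h ->
  (forall A D, g (f A ⊗ f D) = h (f A ⊗ f D)) -> g =1 h.
Proof.
move=> gl hl.
pose gL : {linear (L ⊗ L)%type -> K^o} :=
  HB.pack g (GRing.isLinear.Build K (L ⊗ L)%type K^o _ (g : _ -> K^o) gl).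
pose hL : {linear (L ⊗ L)%type -> K^o} :=
  HB.pack h (GRing.isLinear.Build K (L ⊗ L)%type K^o _ (h : _ -> K^o) hl).
exact: (monom_tensor_ext hb (g := gL) (h := hL)).
Qed.

Lemma coef_monom_gen_mul A D A' D' c :
  coef hb A D (f A' ⊗ (e c * f D')) =
  if c \in D then (-1) ^+ theta [fset c] (D `\ c) * ((A' == A) && (D' == D `\ c))%:R
  else 0.
Proof.
have [cD'|cD'] := boolP (c \in D').
  rewrite gen_mul_monom_in // !linear0; case: ifP => // _.
  by case: (D' =P _) cD' => [->|_]; rewrite ?in_fsetD1 ?eqxx ?andbF ?mulr0.
rewrite gen_mul_monom // !linearZ /= coef_monom; case: ifP => cD.
  have -> : (c |` D' == D) = (D' == D `\ c).
    by apply/eqP/eqP => [<-|->]; rewrite ?fsetU1K ?fsetD1K.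
  by case: (D' =P _) => [->|_] //; rewrite andbF !mulr0.
case: (c |` D' =P D) => [/fsetP/(_ c)|_]; last by rewrite andbF mulr0.
by rewrite fset1U1 cD.
Qed.

(** The state before the step is read off from its result: [c] has replaced [h] in the left set, and
    [h] has joined the right one. *)
Definition move_coef c A D h (z : L ⊗ L) : K :=
  if (h < c)%O && (h \notin A)
  then swap_coef p c (h |` (A `\ c)) h * (-1) ^+ theta [fset h] (D `\ h)
       * coef hb (h |` (A `\ c)) (D `\ h) z
  else 0.

(** The sign comes from [braiding_gen_monom]; a replacement preserves the size of the left set, so
    [A] may be used in the exponent. *)
Definition step_coef c A D (z : L ⊗ L) : K :=
  (-1) ^+ #|` A| *
  ((if c \in D then p ^+ theta A [fset c] * (-1) ^+ theta [fset c] (D `\ c)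
                    * coef hb A (D `\ c) z else 0)
   + (if c \in A then \sum_(h <- D) move_coef c A D h z else 0)).

Lemma step_coef_is_scalar c A D : scalar (step_coef c A D).
Proof.
move=> a t u; rewrite /step_coef mulrCA -mulrDr; congr (_ * _).
rewrite mulrDr addrACA; congr (_ + _).
  by case: ifP => _; [rewrite linearP /=; ring|rewrite mulr0 addr0].
case: ifP => _; last by rewrite mulr0 addr0.
rewrite mulr_sumr -big_split; apply: eq_bigr => h _; rewrite /move_coef /=.
by case: ifP => _; [rewrite linearP /=; ring|rewrite mulr0 addr0].
Qed.

Lemma coef_hexl c A D z : coef hb A D (hexl T (e c) z) = step_coef c A D z.
Proof.
apply: (@monom_tensor_scalar_ext (fun z => coef hb A D (hexl T (e c) z))) z.
- by move=> a t u; rewrite !linearP.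
- exact: step_coef_is_scalar.
move=> A' D'; rewrite (hexlE hT) (braiding_gen_monom htau hT).
pose lin : {scalar (L ⊗ L)%type} := coef hb A D \o tmap idfun (mulr (f D')).
rewrite -[LHS]/(lin _).
have linE u w : lin (u ⊗ w) = coef hb A D (u ⊗ (w * f D')) by rewrite /= tmapE.
move: lin linE => lin linE; rewrite linearZ linearD linearZ linear_sum /= linE.
have lin_swap h : lin (swap_term b p c A' h) =
    if (h < c)%O && (c \notin A') && (h \in D) then
      swap_coef p c A' h * (-1) ^+ theta [fset h] (D `\ h)
      * ((c |` (A' `\ h) == A) && (D' == D `\ h))%:R else 0.
  rewrite /swap_term; case: ifP => _; last by rewrite linear0.
  by rewrite linearZ /= linE coef_monom_gen_mul; case: ifP => _; rewrite ?mulr0 ?mulrA.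
rewrite (eq_bigr _ (fun h _ => lin_swap h)) coef_monom_gen_mul /step_coef coef_monom.
rewrite !mulrDr; congr (_ + _).
  case: ifP => _; last by rewrite !mulr0.
  by case: (A' =P A) => [->|_] /=; rewrite ?mulr0 // !mulrA.
(* One sum runs over [A'], the other over [D]; both are cut down to the common elements, the only
   ones that contribute. *)
rewrite -(@big_fset_incl _ _ _ _ (A' `&` D)) ?fsubsetIl //; last first.
  by move=> h hA'; rewrite in_fsetI hA' /= => /negPf->; rewrite andbF.
have -> : (if c \in A then \sum_(h <- D) move_coef c A D h (f A' ⊗ f D') else 0) =
    \sum_(h <- D) (if c \in A then move_coef c A D h (f A' ⊗ f D') else 0).
  by case: ifP => // _; rewrite big1.
rewrite -[in RHS](@big_fset_incl _ _ _ _ (A' `&` D)) ?fsubsetIr //; last first.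
  move=> h hD; rewrite in_fsetI hD andbT /move_coef coef_monom => hA'.
  case: ifP => // _; case: ifP => // _.
  case: (A' =P _) => [E|_]; last by rewrite mulr0.
  by rewrite E fset1U1 in hA'.
rewrite !mulr_sumr; apply: eq_big_seq => h; rewrite in_fsetI => /andP[hA' hD].
rewrite hD andbT /move_coef coef_monom.
case: (ltP h c) => hc /=; last by rewrite if_same !mulr0.
(* Replacing [h] by [c] is invertible: the left set before the step is determined by the one after
   it. *)
have E : (c \notin A') && (c |` (A' `\ h) == A) =
         [&& c \in A, h \notin A & A' == h |` (A `\ c)].
  apply/andP/and3P => [[cA' /eqP <-]|[cA hA /eqP ->]].
    rewrite fset1U1 in_fset1U in_fsetD1 eqxx (lt_eqF hc) fsetU1K.
      by rewrite fsetD1K.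
    by rewrite in_fsetD1 negb_and cA' orbT.
  rewrite in_fset1U in_fsetD1 eqxx (gt_eqF hc) fsetU1K ?fsetD1K //.
  by rewrite in_fsetD1 negb_and hA orbT.
transitivity ((-1) ^+ #|` A'| * (swap_coef p c A' h * (-1) ^+ theta [fset h] (D `\ h)
    * (((c \notin A') && (c |` (A' `\ h) == A)) && (D' == D `\ h))%:R)).
  by case: (c \in A') => //=; rewrite !mulr0.
rewrite E; case: (boolP (c \in A)) => cA /=; last by rewrite !mulr0.
case: (boolP (h \in A)) => hA /=; first by rewrite !mulr0.
case: (A' =P _) => [A'E|_] /=; last by rewrite !mulr0.
rewrite -A'E; congr (_ ^+ _ * _).
by rewrite A'E cardfsU1 (cardfsD1 c A) cA in_fsetD1 negb_and hA orbT.
Qed.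

End Recursion.

(** * The expected coefficients *)

Section Weights.
Variables (K : fieldType) (d : Order.disp_t) (B : orderType d) (p : K).
Implicit Types (A C D E F G H : {fset B}) (e g h : B).

(** These conditions describe the pairs [(F', E')] arising from exchanges of equally large [G] and
    [H], as [exchange_compat] and [compat_subset] show. *)
Definition compat E F A D : bool :=
  [&& A `&` D == E `&` F, A `|` D == E `|` F & #|` A| == #|` F|].

(* (-1) ^ (|E||F|) times the sign and the power of p in beta, for F' = A and
   E' = D: then G `|` C = A `&` E and Fdot = A `\` E. *)
Definition weight E F A D : K :=
  (-1) ^+ (#|` E| * #|` F| + theta F E + theta A D)
  * p ^+ (theta (A `&` E) E + theta (A `\` E) D).

Definition expected_coef E F A D : K :=
  if compat E F A D then weight E F A D * alpha p (A `\` F) (F `\` A) else 0.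

(** What the elements of [G] contribute to [alpha] once a new least element has been added to
    [G]. *)
Definition alpha_shift G H : K :=
  \prod_(g <- G) (p ^ ((theta [fset g] H)%:Z - (theta [fset g] G).+1%:Z) - 1).

Lemma alphaU1l e G H : e \notin G -> {in G, forall g, (e < g)%O} ->
  alpha p (e |` G) H = (p ^+ theta [fset e] H - 1) * alpha_shift G H.
Proof.
move=> eG eltG; rewrite /alpha big_fsetU1 //=; congr (_ * _).
  rewrite [theta _ (e |` G)]theta_eq0 ?subr0 // => _ g /fset1P->.
  by rewrite in_fset1U => /orP[/eqP->//|/eltG/ltW].
apply: eq_big_seq => g gG; congr (p ^ _ - 1).
by rewrite !thetaU1r // !theta1E (eltG _ gG).
Qed.

(** An [h] below all of [G] raises each [theta [fset g] H] by one, which cancels the shift. *)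
Lemma alpha_shiftU1r h G H : h \notin H -> {in G, forall g, (h < g)%O} ->
  alpha_shift G (h |` H) = alpha p G H.
Proof.
move=> hH hltG; apply: eq_big_seq => g gG; congr (p ^ _ - 1).
by rewrite thetaU1r // theta1E hltG //=; lia.
Qed.

Lemma eq_alpha G H H' :
  {in G, forall g, theta [fset g] H = theta [fset g] H'} -> alpha p G H = alpha p G H'.
Proof. by move=> eqH; apply: eq_big_seq => g gG; rewrite eqH. Qed.

Lemma expected_coef0 F A D : expected_coef fset0 F A D = ((F == A) && (fset0 == D))%:R.
Proof.
rewrite /expected_coef /compat fset0I fset0U; case: ifP => [/and3P[/eqP AD /eqP ADF /eqP cA]|].
  have FA : F = A.
    by apply/eqP; rewrite eq_sym eqEfcard -ADF fsubsetUl ADF cA leqnn.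
  have D0 : D = fset0 by rewrite -AD; apply/esym/fsetIidPr; rewrite -FA -ADF fsubsetUr.
  rewrite FA D0 !eqxx /weight fsetDv /alpha big_seq_fset0 mulr1.
  by rewrite cardfs0 fsetI0 !theta0l !theta0r mul1r expr0.
by case: (F =P A) => [->|//]; case: (fset0 =P D) => [<-|//]; rewrite fsetI0 fsetU0 !eqxx.
Qed.

Lemma signr_parity m n : odd m = odd n -> (-1) ^+ m = (-1) ^+ n :> K.
Proof. by move=> mn; rewrite -signr_odd mn signr_odd. Qed.

Fact regroup (s t u v w a x y x' y' : K) : u * u = 1 -> x * y = x' * y' ->
  s * (a * x * t * v * (w * y)) = u * (a * x') * (u * (s * t * v * w) * y').
Proof.
move=> u1 xy; transitivity (s * t * v * w * a * (x * y)); first by ring.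
rewrite xy -[LHS]mul1r -u1; ring.
Qed.

(** * Compatible pairs when a new least element is added to E *)

Section Step.
Variables (e : B) (E F A D : {fset B}).
Variables (eE : {in E, forall y, (e < y)%O}).

Lemma step_notin : e \notin E.
Proof. by apply/negP => /eE; rewrite ltxx. Qed.

Lemma compat_stay : e \in D -> compat E F A (D `\ e) = compat (e |` E) F A D.
Proof.
have /negPf enE := step_notin => eD; rewrite /compat.
(* At [e] the union condition before the step becomes the intersection condition after it, so both
   are supplied at that point. *)
apply/and3P/and3P => -[/eqP/fsetP I /eqP/fsetP U cA]; split=> //; apply/eqP/fsetP => y;
  move: (I y) (U y) (I e) (U e); rewrite !inE ?eqxx enE eD;
  case: (eqVneq y e) => [->|ye] /=; rewrite ?enE ?eD;
  do ?case: (_ \in _) => //.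
Qed.

Lemma compat_move h : e \in A -> h \in D -> (h < e)%O -> h \notin A ->
  compat E F (h |` (A `\ e)) (D `\ h) = compat (e |` E) F A D.
Proof.
have /negPf enE := step_notin => eA hD he hA.
have /negPf hE : h \notin E by apply/negP => /eE; rewrite (lt_gtF he).
have -> : compat E F (h |` (A `\ e)) (D `\ h) =
    [&& (h |` (A `\ e)) `&` (D `\ h) == E `&` F,
        (h |` (A `\ e)) `|` (D `\ h) == E `|` F & #|` A| == #|` F|].
  by rewrite /compat cardfsU1 (cardfsD1 e A) eA in_fsetD1 negb_and hA orbT.
rewrite /compat.
apply/and3P/and3P => -[/eqP/fsetP I /eqP/fsetP U cA]; split=> //; apply/eqP/fsetP => y;
  move: (I y) (U y) (I e) (U e) (I h) (U h);
  rewrite !inE ?eqxx enE hE hD eA (negPf hA) ?(lt_eqF he) ?(gt_eqF he);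
  (case: (eqVneq y e) => [->|ye]; last case: (eqVneq y h) => [->|yh]);
  rewrite ?enE ?hE ?hD ?eA ?(negPf hA) ?(lt_eqF he) ?(gt_eqF he) /=;
  do ?case: (_ \in _) => //.
Qed.

Variable cp : compat (e |` E) F A D.

Lemma compat_card : #|` A| = #|` F|.
Proof. by case/and3P: cp => _ _ /eqP. Qed.

Lemma compat_mem y : ((y \in A) && (y \in D) = (y \in e |` E) && (y \in F)) *
  ((y \in A) || (y \in D) = (y \in e |` E) || (y \in F)).
Proof.
by case/and3P: cp => /eqP/fsetP/(_ y) + /eqP/fsetP/(_ y); rewrite !in_fsetI !in_fsetU => -> ->.
Qed.

(** There are no elements of [E] below [e], so there [A] and [D] partition [F]. *)
Lemma compat_lt y : (y < e)%O -> (~~ ((y \in A) && (y \in D))) *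
  ((y \in A) || (y \in D) = (y \in F)) * (y \notin E).
Proof.
move=> ye; have [-> ->] := compat_mem y; rewrite in_fset1U (lt_eqF ye) /=.
suff /negPf-> : y \notin E by [].
by apply/negP => /eE; rewrite (lt_gtF ye).
Qed.

Lemma compat_e : ((e \in A) && (e \in D) = (e \in F)) * ((e \in A) || (e \in D)).
Proof. by have [-> ->] := compat_mem e; rewrite fset1U1. Qed.

Lemma compat_diff y : y \in A `\` F -> (y == e) || (e < y)%O.
Proof.
rewrite in_fsetD => /andP[yF yA]; have [_] := compat_mem y.
by rewrite yA (negPf yF) orbF /= in_fset1U => /esym/orP[->//|/eE->]; rewrite orbT.
Qed.

Lemma theta_compat : theta [fset e] F = (theta [fset e] A + theta [fset e] D)%N.
Proof.
case/and3P: cp => /eqP AD /eqP AUD _.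
rewrite -thetaUIr AD AUD thetaUIr thetaU1r ?step_notin // theta1E ltxx add0n.
by rewrite (@theta_eq0 _ _ [fset e] E) // => _ y /fset1P-> /eE/ltW.
Qed.

(** Identifies the exponent left by the telescoping sum, a count in [D], with the one in the factor
    of [alpha] at [e]. *)
Lemma theta_compat_diff : theta [fset e] (F `\` A) = theta [fset e] D.
Proof.
have := theta_compat; rewrite (thetaIDr F A) (thetaIDr A F) [A `&` F]fsetIC.
rewrite (@theta_eq0 _ _ [fset e] (A `\` F)) ?addn0 => [/addnI//|_ y /fset1P-> /compat_diff].
by case/orP => [/eqP->|/ltW].
Qed.

End Step.

(** * Signs and powers of p in one step *)

Section StepWeights.
Variables (e : B) (E F : {fset B}).
Variables (eE : {in E, forall y, (e < y)%O}).
Let enE : e \notin E := step_notin eE.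

Lemma theta_e_E : theta [fset e] E = 0%N.
Proof. by rewrite theta_eq0 // => _ y /fset1P-> /eE/ltW. Qed.

(** If [e] is in [A], it belongs to the difference of [A] and [E] before the step and contributes
    [theta [fset e] D]; afterwards it lies in the intersection and contributes 0. The other
    contributions match once [theta A [fset e]] is split along [E]. *)
Lemma weight_stay A D : e \notin D -> compat (e |` E) F A (e |` D) ->
  (-1) ^+ #|` A| * (p ^+ theta A [fset e] * (-1) ^+ theta [fset e] D * weight E F A D) =
  (if e \in A then p ^+ theta [fset e] D else 1) * weight (e |` E) F A (e |` D).
Proof.
move=> eD cp; rewrite /weight.
have eAF : (e \in F) = (e \in A) by rewrite -(compat_e cp).1 fset1U1 andbT.
have cA := compat_card cp; have thF := theta_compat eE cp.
have triF := theta_trichotomy e F; have triA := theta_trichotomy e A.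
have -> : (-1) ^+ (#|` e |` E| * #|` F| + theta F (e |` E) + theta A (e |` D)) =
    (-1) ^+ #|` A| * (-1) ^+ theta [fset e] D
    * (-1) ^+ (#|` E| * #|` F| + theta F E + theta A D) :> K.
  rewrite -!exprD; apply: signr_parity; move: thF triF.
  rewrite cardfsU1 enE mulnDl mul1n !thetaU1r // theta1E ltxx add0n eAF -cA.
  move: (#|` E| * #|` A|)%N => EA; lia.
set s := (-1) ^+ _; set t := (-1) ^+ theta _ _; set u := (-1) ^+ _.
suff pw : p ^+ theta A [fset e] * p ^+ (theta (A `&` E) E + theta (A `\` E) D) =
   (if e \in A then p ^+ theta [fset e] D else 1) *
   p ^+ (theta (A `&` (e |` E)) (e |` E) + theta (A `\` (e |` E)) (e |` D)).
  transitivity (s * t * u * (p ^+ theta A [fset e]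
    * p ^+ (theta (A `&` E) E + theta (A `\` E) D))); first by ring.
  by rewrite pw mulrCA.
rewrite (thetaIDl A E [fset e]).
have AE1 : A `&` (e |` E) = if e \in A then e |` (A `&` E) else A `&` E.
  by rewrite fsetIC fsetU1I fsetIC.
have AE2 : A `\` E = if e \in A then e |` (A `\` (e |` E)) else A `\` (e |` E).
  case: ifP => eA; apply/fsetP => y; rewrite !inE; case: eqVneq => [->|//] /=;
  by rewrite ?enE ?eA.
rewrite AE1 AE2; case: ifP => eA; last first.
  rewrite mul1r -exprD !thetaU1r //; congr (_ ^+ _); lia.
have e1 : e \notin A `&` E by rewrite in_fsetI (negPf enE) andbF.
have e2 : e \notin A `\` (e |` E) by rewrite in_fsetD fset1U1.
rewrite -!exprD; congr (_ ^+ _); rewrite !(thetaU1l _ e1) !(thetaU1l _ e2) !thetaU1r //.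
rewrite theta_e_E !theta1E ltxx; lia.
Qed.

(** The sign [(-1) ^+ (e \in F)] is the defect when elements of [F] above [e] are traded for those
    below it by [theta_trichotomy]. *)
Lemma weight_move A D h : e \notin A -> h \notin A -> h \notin D -> (h < e)%O ->
  compat (e |` E) F (e |` A) (h |` D) ->
  (-1) ^+ #|` e |` A| * (swap_coef p e (h |` A) h * (-1) ^+ theta [fset h] D
    * weight E F (h |` A) D) =
  (-1) ^+ (e \in F) * ((p - 1) * p ^+ theta [fset h] (h |` D))
    * weight (e |` E) F (e |` A) (h |` D).
Proof.
move=> eA hA hD he cp; rewrite /weight /swap_coef.
have hE : h \notin E by have [] := compat_lt eE cp he.
have cA := compat_card cp; have thF := theta_compat eE cp.
have triF := theta_trichotomy e F; have triA := theta_trichotomy h A.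
have -> : (-1) ^+ (#|` e |` E| * #|` F| + theta F (e |` E) + theta (e |` A) (h |` D)) =
    (-1) ^+ (e \in F) * ((-1) ^+ #|` e |` A|
    * (-1) ^+ (theta [fset e] (h |` A) + theta [fset h] (h |` A))
    * (-1) ^+ theta [fset h] D
    * (-1) ^+ (#|` E| * #|` F| + theta F E + theta (h |` A) D)) :> K.
  rewrite -!exprD; apply: signr_parity; move: cA thF triF.
  rewrite !cardfsU1 enE eA mulnDl mul1n !thetaU1l // !thetaU1r // !theta1E !ltxx he.
  rewrite (negPf hA) in triA.
  move: (#|` E| * #|` F|)%N => EF; lia.
have pw : p ^+ theta (h |` A) [fset h] * p ^+ (theta ((h |` A) `&` E) E
      + theta ((h |` A) `\` E) D) =
    p ^+ theta [fset h] (h |` D) * p ^+ (theta ((e |` A) `&` (e |` E)) (e |` E)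
      + theta ((e |` A) `\` (e |` E)) (h |` D)).
  rewrite -!exprD; congr (_ ^+ _).
  have -> : (e |` A) `&` (e |` E) = e |` (A `&` E).
    by apply/fsetP => y; rewrite !inE; case: eqVneq.
  have -> : (e |` A) `\` (e |` E) = A `\` E.
    by apply/fsetP => y; rewrite !inE; case: eqVneq => [->|//]; rewrite (negPf eA) andbF.
  rewrite fsetU1I fsetU1D (negPf hE).
  have eAE : e \notin A `&` E by rewrite in_fsetI (negPf eA).
  have hAE : h \notin A `\` E by rewrite in_fsetD (negPf hA) andbF.
  rewrite !thetaU1l // !thetaU1r // (thetaIDl A E [fset h]) theta_e_E !theta1E !ltxx.
  (* The common part of [A] and [E] lies above [e], hence above [h], and is counted in full against
     either one. *)
  have gtE x : (x <= e)%O -> theta (A `&` E) [fset x] = #|` A `&` E|.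
    move=> xe; rewrite theta_eqM ?cardfs1 ?muln1 // => y _ + /fset1P->.
    by rewrite in_fsetI => /andP[_ /eE]; apply: le_lt_trans.
  by rewrite (gtE _ (ltW he)) (gtE _ (lexx e)); lia.
by apply: regroup => //; rewrite -signr_addb addbb.
Qed.

End StepWeights.

End Weights.

(** * The recursion for the expected coefficients *)

Section ExpectedStep.
Variables (K : fieldType) (d : Order.disp_t) (B : orderType d) (p : K).
Variables (e : B) (E F : {fset B}).
Variables (eE : {in E, forall y, (e < y)%O}).
Implicit Types (A D : {fset B}) (h : B).

Lemma expected_stay A D : e \in D -> compat (e |` E) F A D ->
  (-1) ^+ #|` A| * (p ^+ theta A [fset e] * (-1) ^+ theta [fset e] (D `\ e)
    * expected_coef p E F A (D `\ e)) =
  (if e \in A then p ^+ theta [fset e] D else 1) * expected_coef p (e |` E) F A D.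
Proof.
move=> eD cp; rewrite /expected_coef compat_stay // cp.
have eD' : e \notin D `\ e by rewrite in_fsetD1 eqxx.
have thD : theta [fset e] D = theta [fset e] (D `\ e).
  by rewrite -{1}(fsetD1K eD) thetaU1r // theta1E ltxx.
have cp' : compat (e |` E) F A (e |` (D `\ e)) by rewrite fsetD1K.
have := weight_stay p eE eD' cp'; rewrite fsetD1K // thD => ws.
by rewrite [X in _ * X]mulrA [LHS]mulrA ws mulrA.
Qed.

(** If [e] is in [F], then [e] replaces [h] in the removed part of [F]; every relevant [g] is above
    both, so [alpha] is unchanged. Otherwise [e] leaves [G] and [h] leaves [H], which gives
    [alpha_shift], and the factor [p - 1] accounts for its sign. *)
Lemma expected_move A D h : e \in A -> h \in D -> (h < e)%O ->
    compat (e |` E) F A D ->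
  (-1) ^+ #|` A| * (swap_coef p e (h |` (A `\ e)) h * (-1) ^+ theta [fset h] (D `\ h)
    * expected_coef p E F (h |` (A `\ e)) (D `\ h)) =
  (1 - p) * p ^+ theta [fset h] D * (weight p (e |` E) F A D
    * if e \in F then alpha p (A `\` F) (F `\` A)
      else - alpha_shift p ((A `\` F) `\ e) (F `\` A)).
Proof.
move=> eA hD he cp.
have [[hAD hF] hE] := compat_lt eE cp he.
have hA : h \notin A by move: hAD; rewrite hD andbT.
rewrite hD orbT in hF; rewrite /expected_coef compat_move // cp.
have eA1 : e \notin A `\ e by rewrite in_fsetD1 eqxx.
have hA1 : h \notin A `\ e by rewrite in_fsetD1 negb_and hA orbT.
have hD1 : h \notin D `\ h by rewrite in_fsetD1 eqxx.
have cp' : compat (e |` E) F (e |` (A `\ e)) (h |` (D `\ h)) by rewrite !fsetD1K.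
have := weight_move p eE eA1 hA1 hD1 he cp'; rewrite !fsetD1K // => wm.
rewrite [X in _ * X]mulrA [LHS]mulrA wm -[LHS]mulrA -[in RHS]mulrA.
have hlt g : g \in (A `\` F) `\ e -> (e < g)%O.
  by rewrite in_fsetD1 => /andP[/negPf ge /(compat_diff eE cp)]; rewrite ge.
have -> : (h |` (A `\ e)) `\` F = (A `\` F) `\ e.
  rewrite fsetU1D -hF; apply/fsetP => y; rewrite !inE.
  by case: (y \in F); rewrite ?andbF.
have [eF|eF] := boolP (e \in F).
  have -> : (A `\` F) `\ e = A `\` F.
    by apply/fsetP => y; rewrite !inE; case: eqVneq => // ->; rewrite eF.
  have eqal : alpha p (A `\` F) (F `\` (h |` (A `\ e))) = alpha p (A `\` F) (F `\` A).
    apply: eq_alpha => g gAF.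
    have eg : (e < g)%O.
      by have := compat_diff eE cp gAF; case: eqVneq => // ge; rewrite ge in_fsetD eF in gAF.
    pose H0 := F `\` (h |` A).
    have -> : F `\` (h |` (A `\ e)) = e |` H0.
      apply/fsetP => y; rewrite !inE; case: (eqVneq y e) => [->|//].
      by rewrite (gt_eqF he) eF.
    have -> : F `\` A = h |` H0.
      apply/fsetP => y; rewrite !inE; case: (eqVneq y h) => [->|//].
      by rewrite -hF hA.
    by rewrite !thetaU1r ?inE ?eqxx ?eA ?orbT // !theta1E eg (lt_trans he eg).
  by rewrite eqal /= expr1; ring.
have -> : F `\` A = h |` (F `\` (h |` (A `\ e))).
  apply/fsetP => y; rewrite !inE; case: (eqVneq y h) => [->|] /=; first by rewrite hA -hF.
  by case: (eqVneq y e) => [->|//]; rewrite (negPf eF) !andbF.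
rewrite alpha_shiftU1r ?inE ?eqxx //; last by move=> g /hlt; apply: lt_trans.
by rewrite expr0; ring.
Qed.

Lemma expected_coef_step A D :
  (-1) ^+ #|` A| *
  ((if e \in D then p ^+ theta A [fset e] * (-1) ^+ theta [fset e] (D `\ e)
                    * expected_coef p E F A (D `\ e) else 0)
   + (if e \in A then \sum_(h <- D)
        (if (h < e)%O && (h \notin A)
         then swap_coef p e (h |` (A `\ e)) h * (-1) ^+ theta [fset h] (D `\ h)
              * expected_coef p E F (h |` (A `\ e)) (D `\ h)
         else 0)
      else 0)) = expected_coef p (e |` E) F A D.
Proof.
have [cp|ncp] := boolP (compat (e |` E) F A D); last first.
  rewrite [RHS]/expected_coef (negPf ncp) (_ : (if e \in D then _ else 0) = 0); last first.
    by case: ifP => // eD; rewrite /expected_coef compat_stay // (negPf ncp) mulr0.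
  rewrite add0r (_ : (if e \in A then _ else 0) = 0) ?mulr0 //; case: ifP => // eA.
  rewrite big_seq big1 // => h hD; case: ifP => // /andP[he hA].
  by rewrite /expected_coef compat_move // (negPf ncp) mulr0.
rewrite mulrDr.
have -> : (-1) ^+ #|` A| * (if e \in D then p ^+ theta A [fset e]
      * (-1) ^+ theta [fset e] (D `\ e) * expected_coef p E F A (D `\ e) else 0) =
    if e \in D then (if e \in A then p ^+ theta [fset e] D else 1)
      * expected_coef p (e |` E) F A D else 0.
  by case: ifP => eD; rewrite ?mulr0 ?expected_stay.
set X := weight p (e |` E) F A D
    * if e \in F then alpha p (A `\` F) (F `\` A)
      else - alpha_shift p ((A `\` F) `\ e) (F `\` A).
(* The factor [X] does not depend on [h], so the sum over [h] telescopes. *)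
rewrite (_ : _ * (if e \in A then _ else 0) =
    if e \in A then (1 - p ^+ theta [fset e] D) * X else 0); last first.
  case: ifP => eA; last by rewrite mulr0.
  rewrite -telescope_theta mulr_sumr mulr_suml; apply: eq_big_seq => h hD.
  have [he|he] := boolP (h < e)%O; last by rewrite mulr0 mul0r.
  have [[hAD _] _] := compat_lt eE cp he; rewrite hD andbT in hAD.
  by rewrite hAD /= expected_move.
have [eAD eAUD] := compat_e cp; rewrite /X -eAD /expected_coef cp.
have [eA|eA] := boolP (e \in A); last first.
  by have -> : e \in D; [move: eAUD; rewrite (negPf eA)|rewrite mul1r addr0].
(* With [e] in both sets, hence in [F], the factors [p ^+ theta [fset e] D] and its complement to 1
   add up to 1. *)
have [eD|eD] := boolP (e \in D) => /=; first by ring.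
have eF : e \notin F by rewrite -eAD (negPf eD) andbF.
have eAF : e \in A `\` F by rewrite in_fsetD eA eF.
(* Now [e] is the least element exchanged, and the telescoped sum supplies its factor in [alpha]. *)
rewrite add0r -{2}(fsetD1K eAF) alphaU1l; last 2 first.
- by rewrite in_fsetD1 eqxx.
- by move=> g; rewrite in_fsetD1 => /andP[/negPf ge /(compat_diff eE cp)]; rewrite ge.
by rewrite (theta_compat_diff eE cp); ring.
Qed.

End ExpectedStep.

(** * Uniqueness and nonvanishing of the coefficients *)

Section Nonvanishing.
Variables (d : Order.disp_t) (B : orderType d).
Implicit Types (G H : {fset B}) (g h : B).

Lemma theta_leq g h H : (g <= h)%O -> (theta [fset g] H <= theta [fset h] H)%N.
Proof.
move=> gh; rewrite /theta !big_seq_fset1; apply: leq_sum => x _.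
by case: (ltP x g) => // xg; rewrite (lt_le_trans xg gh).
Qed.

(* The k-th element of G, counted from 0, has theta = k, so a first failure of the
   strict inequality would be an equality. *)
Lemma theta_neq_lt G H (k : nat) :
  {in G, forall g, (k <= theta [fset g] H)%N} ->
  {in G, forall g, (k + theta [fset g] G)%N != theta [fset g] H} ->
  {in G, forall g, (k + theta [fset g] G < theta [fset g] H)%N}.
Proof.
elim/fset_min_ind: G k => [|x G xG IH] k kle kneq; first by move=> g; rewrite inE.
have xnG : x \notin G by apply/negP => /xG; rewrite ltxx.
have thx : theta [fset x] (x |` G) = 0%N.
  rewrite theta_eq0 // => _ y /fset1P->.
  by rewrite in_fset1U => /orP[/eqP->|/xG/ltW].
have thG g : g \in G -> theta [fset g] (x |` G) = (theta [fset g] G).+1.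
  by move=> /xG xg; rewrite thetaU1r // theta1E xg.
have kx : (k < theta [fset x] H)%N.
  have := kneq x; rewrite fset1U1 thx addn0 ltn_neqAle => /(_ isT) ->.
  by apply: kle; rewrite fset1U1.
move=> g; rewrite in_fset1U => /orP[/eqP->|gG]; first by rewrite thx addn0.
rewrite thG // -addSnnS; apply: IH => // y yG.
  by apply: (leq_trans kx); apply: theta_leq; apply/ltW/xG.
by rewrite addSnnS -thG // kneq // in_fset1U yG orbT.
Qed.

(** As [p] is not a root of unity, a factor vanishes only when its exponent is 0; [theta_neq_lt]
    then upgrades the inequalities from distinctness to strict order. *)
Lemma alpha_neq0 (K : fieldType) (p : K) G H : p != 0 ->
  (forall n : nat, (0 < n)%N -> p ^+ n != 1) ->
  (alpha p G H != 0 <-> forall g, g \in G -> (theta [fset g] G < theta [fset g] H)%N).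
Proof.
move=> p0 pn.
have expz1 (z : int) : (p ^ z == 1) = (z == 0).
  case: z => [[|n]|n]; first by rewrite !eqxx.
    by apply/negbTE; rewrite -exprnP pn.
  by apply/negbTE; rewrite NegzE -exprnN invr_eq1 pn.
have -> : alpha p G H != 0 <->
    {in G, forall g, (0 + theta [fset g] G)%N != theta [fset g] H}.
  rewrite /alpha prodf_seq_neq0; split=> [/allP h g gG|h].
    by have := h g gG; rewrite /= subr_eq0 expz1 subr_eq0 eq_sym.
  by apply/allP => g gG; rewrite /= subr_eq0 expz1 subr_eq0 eq_sym; apply: h.
split=> [h g gG|h g gG]; last by rewrite add0n neq_ltn h.
by have := theta_neq_lt (k := 0) (fun _ _ => isT) h gG.
Qed.

End Nonvanishing.

(** * Recovering G and H from the exchanged sets *)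

Section Exchange.
Variables (d : Order.disp_t) (B : orderType d) (E F : {fset B}).
Implicit Types (A D G H : {fset B}).

Lemma exchange_compat G H A D :
  G `<=` E `\` F -> H `<=` F `\` E -> #|` G| = #|` H| ->
  (exchange F H G == A) && (exchange E G H == D) =
  [&& compat E F A D, G == A `\` F & H == F `\` A].
Proof.
move=> /fsubsetP GE' /fsubsetP HF' cGH.
(* As boolean implications, the inclusions can be used in a case analysis on memberships. *)
have GE y : (y \in G) ==> (y \in E `\` F) by apply/implyP/GE'.
have HF y : (y \in H) ==> (y \in F `\` E) by apply/implyP/HF'.
move: GE HF => {GE' HF'} GE HF; apply/andP/and3P.
  move=> [/eqP<- /eqP<-].
  have G_F : (F `\` H) `&` G = fset0.
    by apply/fsetP => y; move: (GE y); rewrite !inE; do ?case: (_ \in _).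
  have F_H : F `&` H = H.
    by apply/fsetP => y; move: (HF y); rewrite !inE; do ?case: (_ \in _).
  split; first (apply/and3P; split).
  - by apply/eqP/fsetP => y; move: (GE y) (HF y); rewrite !inE;
      do ?case: (_ \in _).
  - by apply/eqP/fsetP => y; move: (GE y) (HF y); rewrite !inE;
      do ?case: (_ \in _).
  - by rewrite cardfsU G_F cardfs0 subn0 cGH -(cardfsID H F) F_H addnC.
  - by apply/eqP/fsetP => y; move: (GE y) (HF y); rewrite !inE;
      do ?case: (_ \in _).
  - by apply/eqP/fsetP => y; move: (GE y) (HF y); rewrite !inE;
      do ?case: (_ \in _).
move=> [/and3P[/eqP/fsetP I /eqP/fsetP U _] /eqP-> /eqP->]; split;
  by apply/eqP/fsetP => y; move: (I y) (U y); rewrite !inE; do ?case: (_ \in _).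
Qed.

Lemma compat_subset A D : compat E F A D ->
  [/\ A `\` F `<=` E `\` F, F `\` A `<=` F `\` E & #|` A `\` F| = #|` F `\` A|].
Proof.
move=> /and3P[/eqP/fsetP I /eqP/fsetP U /eqP cA]; split.
- apply/fsubsetP => y; move: (I y) (U y); rewrite !inE; do ?case: (_ \in _) => //.
- apply/fsubsetP => y; move: (I y) (U y); rewrite !inE; do ?case: (_ \in _) => //.
by apply: (@addnI #|` F `&` A|); rewrite {1}fsetIC !cardfsID.
Qed.

Lemma compat_beta (K : fieldType) (p : K) A D : compat E F A D ->
  weight p E F A D * alpha p (A `\` F) (F `\` A) =
  (-1) ^+ (#|` E| * #|` F|) * beta p E (A `\` F) F (F `\` A).
Proof.
move=> cp; have [GE HF cGH] := compat_subset cp.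
have := exchange_compat A D GE HF cGH; rewrite cp !eqxx => /andP[/eqP FA /eqP ED].
rewrite /beta FA ED /weight -addnA exprD !mulrA.
have -> : (A `\` F) `|` (E `&` F) = A `&` E.
  case/and3P: cp => /eqP/fsetP I /eqP/fsetP U _.
  by apply/fsetP => y; move: (I y) (U y); rewrite !inE; do ?case: (_ \in _).
have -> // : (F `\` E) `\` (F `\` A) = A `\` E.
case/and3P: cp => /eqP/fsetP I /eqP/fsetP U _.
by apply/fsetP => y; move: (I y) (U y); rewrite !inE; do ?case: (_ \in _).
Qed.

Lemma sum_exchange (R : nzRingType) (s : {fset B} -> {fset B} -> R) A D :
  \sum_(0 <= k < #|` E|.+1)
    \sum_(G <- fpowerset (E `\` F) | #|` G| == k)
      \sum_(H <- fpowerset (F `\` E) | #|` H| == k)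
        s G H * ((exchange F H G == A) && (exchange E G H == D))%:R =
  if compat E F A D then s (A `\` F) (F `\` A) else 0.
Proof.
transitivity (\sum_(0 <= k < #|` E|.+1)
    \sum_(G <- fpowerset (E `\` F) | #|` G| == k)
      \sum_(H <- fpowerset (F `\` E) | #|` H| == k)
        s G H * [&& compat E F A D, G == A `\` F & H == F `\` A]%:R).
  apply: eq_bigr => k _; rewrite big_seq_cond [in RHS]big_seq_cond.
  apply: eq_bigr => G /andP[+ /eqP cG]; rewrite fpowersetE => GE.
  rewrite big_seq_cond [in RHS]big_seq_cond; apply: eq_bigr => H /andP[+ /eqP cH].
  by rewrite fpowersetE => HF; rewrite exchange_compat // cG cH.
case: ifP => [cp|_]; last first.
  by rewrite big1 // => k _; rewrite big1 // => G _; rewrite big1 // => H _; rewrite mulr0.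
have [GE HF cGH] := compat_subset cp.
(* The only surviving [k]; it is in range because the elements of [A] outside [F] belong to [E]. *)
rewrite (bigD1_seq #|` A `\` F|) ?iota_uniq //=; last first.
  rewrite mem_index_iota /= ltnS; apply: fsubset_leq_card.
  exact: fsubset_trans GE (fsubsetDl _ _).
rewrite [X in _ + X]big1 ?addr0 => [|k kA]; last first.
  rewrite big1 // => G /eqP cG; rewrite big1 // => H _.
  by case: eqP => [GA|]; rewrite ?mulr0 //; rewrite -cG GA eqxx in kA.
rewrite big_mkcond (bigD1_seq (A `\` F)) ?fset_uniq ?fpowersetE //= eqxx.
rewrite [X in _ + X]big1 ?addr0 => [|G /negPf GA]; last first.
  by case: ifP => // _; rewrite big1 // => H _; rewrite GA mulr0.
rewrite big_mkcond (bigD1_seq (F `\` A)) ?fset_uniq ?fpowersetE //= cGH !eqxx.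
rewrite [X in _ + X]big1 ?addr0 => [|H /negPf HA]; last first.
  by case: ifP => // _; rewrite HA mulr0.
by rewrite mulr1.
Qed.

End Exchange.

(** * Comparison of the braiding with its expansion *)

Section Main.
Variables (K : fieldType) (V : lmodType K) (d : Order.disp_t) (B : orderType d).
Variables (b : B -> V) (hb : is_basis b) (p : K).
Variables (T : {linear (exterior V ⊗ exterior V)%type -> (exterior V ⊗ exterior V)%type}).
Implicit Types (A D E F : {fset B}).
Local Notation f A := (monom b A).

Lemma coef_braiding (tau : V ⊗ V -> V ⊗ V) (htau : is_tau b p tau)
    (hT : is_braiding tau T) E F A D :
  coef hb A D (T (f E ⊗ f F)) = expected_coef p E F A D.
Proof.
elim/fset_min_ind: E A D => [|e E eE IH] A D.
  by rewrite monom0 (braiding_1l hT) -(monom0 b) coef_monom expected_coef0.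
rewrite monomU1 // (braiding_mull hT) (coef_hexl hb htau hT) -(expected_coef_step p F eE).
rewrite /step_coef IH; congr (_ * (_ + _)); case: ifP => // _; apply: eq_bigr => h _.
by rewrite /move_coef IH.
Qed.

Lemma coef_expansion E F (s : {fset B} -> {fset B} -> K) A D :
  coef hb A D ((-1) ^+ (#|` E| * #|` F|) *:
    \sum_(0 <= k < #|` E|.+1)
      \sum_(G <- fpowerset (E `\` F) | #|` G| == k)
        \sum_(H <- fpowerset (F `\` E) | #|` H| == k)
          s G H *: (f (exchange F H G) ⊗ f (exchange E G H))) =
  (-1) ^+ (#|` E| * #|` F|) * if compat E F A D then s (A `\` F) (F `\` A) else 0.
Proof.
rewrite linearZ /= -sum_exchange; congr (_ * _).
rewrite [LHS]linear_sum; apply: eq_bigr => k _.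
rewrite [LHS]linear_sum; apply: eq_bigr => G _.
rewrite [LHS]linear_sum; apply: eq_bigr => H _.
by rewrite [LHS]linearZ /= coef_monom.
Qed.

End Main.

Theorem proposition4 (K : fieldType) (V : lmodType K)
    (d : Order.disp_t) (B : orderType d) (b : B -> V) (hb : is_basis b)
    (p : K) (hp : p != 0)
    (tau : {linear (V ⊗ V)%type -> (V ⊗ V)%type}) (htau : is_tau b p tau)
    (T : {linear (exterior V ⊗ exterior V)%type -> (exterior V ⊗ exterior V)%type})
    (hT : is_braiding tau T)
    (E F : {fset B}) :
  (exists s : {fset B} -> {fset B} -> K, braiding_expansion b T E F s) /\
  (forall s : {fset B} -> {fset B} -> K, braiding_expansion b T E F s ->
   forall (k : nat) (G H : {fset B}),
     G `<=` E `\` F -> H `<=` F `\` E -> #|` G| = k -> #|` H| = k ->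
     s G H = beta p E G F H /\
     ((forall n : nat, (0 < n)%N -> p ^+ n != 1) ->
      (s G H != 0 <->
       forall g : B, g \in G ->
         (theta [fset g] G < theta [fset g] H)%N))).
Proof.
split.
  (* Existence holds with [beta] itself: both sides have the same coefficients on all pairs of
     monomials. *)
  exists (fun G H => beta p E G F H); apply: (coef_inj (hb := hb)) => A D.
  rewrite (coef_braiding hb htau hT) coef_expansion /expected_coef.
  by case: ifP => [/compat_beta->|]; rewrite ?mulr0.
move=> s sT k G H GE HF cG cH.
have sGH : s G H = beta p E G F H.
  have cGH : #|` G| = #|` H| by rewrite cG cH.
  (* Taking the coefficient at [(F', E')] isolates [s G H], since this pair determines [G] and
     [H]. *)
  have := exchange_compat (exchange F H G) (exchange E G H) GE HF cGH.
  rewrite !eqxx /= => /esym/and3P[cp /eqP GA /eqP HA].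
  have := coef_braiding hb htau hT E F (exchange F H G) (exchange E G H).
  rewrite sT coef_expansion /expected_coef cp compat_beta // -GA -HA.
  by apply: mulfI; rewrite signr_eq0.
(* The sign and the power of the nonzero [p] are invertible, so only [alpha] can vanish. *)
split=> // pn; rewrite sGH -(alpha_neq0 _ _ hp pn) /beta.
by rewrite !mulf_eq0 signr_eq0 expf_eq0 (negPf hp) andbF.
Qed.
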